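(* Consider two asymptotically stable DAE systems with the same number $m$ of inputs and the same number $p$ of outputs, with realizations $(E,A,B,C)$ and $(E_H,A_H,B_H,C_H)$, where $E,A\in\mathbb{R}^{n\times n}$, $B\in\mathbb{R}^{n\times m}$, $C\in\mathbb{R}^{p\times n}$, $E_H,A_H\in\mathbb{R}^{n_H\times n_H}$, $B_H\in\mathbb{R}^{n_H\times m}$, $C_H\in\mathbb{R}^{p\times n_H}$, and the pencils $\lambda E-A$ and $\lambda E_H-A_H$ are regular. Suppose that the transfer functions $G(s)=C(sE-A)^{-1}B$ and $G_H(s)=C_H(sE_H-A_H)^{-1}B_H$ are strictly proper. Let $\Pi_l^f,\Pi_r^f$ and $\Pi_{Hl}^f,\Pi_{Hr}^f$ be the spectral projectors onto the left and right deflating subspaces of $\lambda E-A$ and of $\lambda E_H-A_H$, respectively, corresponding to the finite eigenvalues. Then the $\mathcal{H}_2$ inner product of $G$ and $G_H$ is given by $$\langle G,G_H\rangle_{\mathcal{H}_2}=\operatorname{tr}\left(C\,X\,C_H^{*}\right)=\operatorname{tr}\left(B^{*}\,Y\,B_H\right),$$ where $X$ and $Y$ are the unique solutions of the projected Sylvester equations $$A X E_H^{*}+E X A_H^{*}+\Pi_l^f B B_H^{*}(\Pi_{Hl}^f)^{*}=0,\qquad X=\Pi_r^f X(\Pi_{Hr}^f)^{*},$$ $$A^{*} Y E_H+E^{*} Y A_H+(\Pi_r^f)^{*} C^{*} C_H\Pi_{Hr}^f=0,\qquad Y=(\Pi_l^f)^{*}\,Y\,\Pi_{Hl}^f .$$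
   Context: A DAE system with realization $(E,A,B,C)$ is $E\dot x(t)=Ax(t)+Bu(t)$, $y(t)=Cx(t)$, with real matrices and $E$ possibly singular. The pencil $\lambda E-A$ is regular if $\det(\lambda E-A)\neq 0$ for some $\lambda\in\mathbb{C}$. The system is asymptotically stable if all finite generalized eigenvalues of $\lambda E-A$ (i.e. all $\lambda\in\mathbb{C}$ with $\det(\lambda E-A)=0$) have negative real part. A rational matrix function is strictly proper if it tends to $0$ as $s\to\infty$. $M^{*}$ denotes the conjugate transpose. Spectral projectors: for a regular pencil there are nonsingular real matrices $P,Q$ bringing it to Weierstrass canonical form $$PEQ=\begin{bmatrix} I_{n_f}&0\\0&N\end{bmatrix},\qquad PAQ=\begin{bmatrix} J&0\\0&I_{n_\infty}\end{bmatrix},$$ with $N$ nilpotent, where the eigenvalues of $J$ are the finite eigenvalues of the pencil. Then $$\Pi_l^f=P^{-1}\begin{bmatrix} I_{n_f}&0\\0&0\end{bmatrix}P,\qquad \Pi_r^f=Q\begin{bmatrix} I_{n_f}&0\\0&0\end{bmatrix}Q^{-1}.$$ $\Pi_{Hl}^f,\Pi_{Hr}^f$ are defined in the same way from $\lambda E_H-A_H$. $\mathcal{H}_2$ inner product: $\mathcal{H}_2$ is the space of $p\times m$ rational matrix functions that are analytic in the closed right half-plane and square integrable on the imaginary axis, with $$\langle G,G_H\rangle_{\mathcal{H}_2}=\frac{1}{2\pi}\int_{-\infty}^{\infty}\operatorname{tr}\left(G(\imath\omega)G_H(\imath\omega)^{*}\right)d\omega .$$ *)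

(* Defs.v *)
From HB Require Import structures.
From mathcomp Require Import all_boot all_order all_algebra.
From mathcomp Require Import complex.
From mathcomp Require Import all_classical all_reals all_analysis.

Set Implicit Arguments.
Unset Strict Implicit.
Unset Printing Implicit Defensive.

Import Order.TTheory GRing.Theory Num.Theory.
Import numFieldNormedType.Exports.

Local Open Scope classical_set_scope.
Local Open Scope sesquilinear_scope.
Local Open Scope ring_scope.

Definition cmx (R : realType) (m n : nat) (M : 'M[R]_(m, n)) : 'M[R[i]]_(m, n) :=
  map_mx (real_complex R) M.

Section Pencil.
Variables (R : realType) (n : nat).
Implicit Types E A : 'M[R]_n.

Definition pencil E A (s : R[i]) : 'M[R[i]]_n := s *: cmx E - cmx A.

Definition regular_pencil E A : Prop := exists s, \det (pencil E A s) != 0.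

Definition asymptotically_stable E A : Prop :=
  forall s, \det (pencil E A s) = 0 -> complex.Re s < 0.

(* The casts along nf + ninf = n only retype the block matrices. *)
Definition spectral_projectors E A (Pl Pr : 'M[R]_n) : Prop :=
  exists (nf ninf : nat) (en : (nf + ninf)%N = n) (P Q : 'M[R]_n)
         (J : 'M[R]_nf) (N : 'M[R]_ninf),
    let blk M := castmx (en, en) M in
    [/\ P \in unitmx /\ Q \in unitmx,
        exists k : nat, N ^+ k = 0,
        P *m E *m Q = blk (block_mx 1%:M 0 0 N),
        P *m A *m Q = blk (block_mx J 0 0 1%:M) &
        Pl = invmx P *m blk (block_mx 1%:M 0 0 0) *m P /\
        Pr = Q *m blk (block_mx 1%:M 0 0 0) *m invmx Q].

(* invmx is the identity on singular matrices, so the value at the (finitely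
   many, if the pencil is regular) generalized eigenvalues is meaningless. *)
Definition transfer (p m : nat) E A (B : 'M[R]_(n, m)) (C : 'M[R]_(p, n))
  (s : R[i]) : 'M[R[i]]_(p, m) := cmx C *m invmx (pencil E A s) *m cmx B.

End Pencil.

Section HardySpace.
Variables (R : realType) (p m : nat).
Implicit Types G : R[i] -> 'M[R[i]]_(p, m).

Definition strictly_proper G : Prop :=
  forall e : R, 0 < e -> exists r : R, forall s : R[i], r%:C%C < `|s| ->
    forall i j, `|G s i j| < e%:C%C.

(* q is a common denominator of the entries; G is unconstrained at its zeros. *)
Definition rational_mxfun G : Prop :=
  exists (q : {poly R[i]}) (N : 'M[{poly R[i]}]_(p, m)), q != 0 /\
    forall s, q.[s] != 0 -> forall i j, G s i j = (N i j).[s] / q.[s].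

Definition analytic_at (f : R[i] -> R[i]) (s : R[i]) : Prop :=
  \forall z \near (s : R[i]^o), derivable (f : R[i]^o -> R[i]^o) z 1.

(* Re tr (M M^* ) is the squared Frobenius norm of M. *)
Definition square_integrable G : Prop :=
  lebesgue_measure.-integrable setT
    (fun w : R => (complex.Re (\tr (G (w *i)%C *m (G (w *i)%C) ^t*)))%:E).

Definition in_H2 G : Prop :=
  [/\ rational_mxfun G,
      forall s, 0 <= complex.Re s -> forall i j, analytic_at (fun z => G z i j) s &
      square_integrable G].

(* The value of the integral when Re f and Im f are integrable, which is
   the case for the product of two square-integrable functions. *)
Definition cintegral (f : R -> R[i]) : R[i] :=
  ((\int[lebesgue_measure]_(w in setT) complex.Re (f w))
   +i* (\int[lebesgue_measure]_(w in setT) complex.Im (f w)))%C.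

Definition H2_inner G (K : R[i] -> 'M[R[i]]_(p, m)) : R[i] :=
  ((2 * pi)^-1 : R)%:C%C *
  cintegral (fun w => \tr (G (w *i)%C *m (K (w *i)%C) ^t*)).

End HardySpace.

(* Main.v *)
Require Import Defs.
From HB Require Import structures.
From mathcomp Require Import all_boot all_order all_algebra.
From mathcomp Require Import complex.
From mathcomp Require Import all_classical all_reals all_analysis.
From mathcomp Require Import measurable_realfun.
From mathcomp Require Import ring lra.

(** Left and right multiplication by the matrices of the two Weierstrass forms
    reduces everything to the finite parts. The resolvent of the infinite part,
    [invmx (s *: N - 1)] with [N] nilpotent, is a polynomial in [s]; since the
    transfer function and the contribution of the finite part both tend to 0 at
    infinity, so does this polynomial, and it vanishes
    ([strictly_proper_transfer]). Hence [G(s) = D (s - J)^-1 B] and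
    [GH(s) = F (s - K)^-1 L] with [J] and [K] stable. A matrix [X] fixed by the
    projectors has a single nonzero block [Z] in these coordinates, and the
    projected equation for [X] becomes the Sylvester equation
    [J Z + Z K^H + B L^H = 0], with [K^H] the conjugate transpose
    ([projected_residual]). It has exactly one solution, because the spectra of
    [J] and of [- K^H] lie on opposite sides of the imaginary axis
    ([sylvester_inj], [sylvester_solve]).

    For the integral no residue calculus is needed. At [s = i w] the Sylvester
    equation is [B L^H = (s - J) Z + Z (s - K)^H], so
    [(s - J)^-1 B L^H (s - K)^-H = Z (s - K)^-H + (s - J)^-1 Z]
    ([inner_split]), and it suffices that the principal value of the integral of
    [(i w - J)^-1] over the real line is [pi] times the identity
    ([pv_resolvent]): the two summands then give [2 pi Z]. This follows from
    Newton's expansion [(s - J)^-1 = \sum_k P_k / ((s - l_0) ... (s - l_k))] with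
    [P_0 = 1], where the [l_j] are the eigenvalues ([newton_expansion]): one
    simple pole with negative real part has principal value [pi]
    ([pv_simple_pole], by explicit antiderivatives), a product of several has
    principal value 0 ([pv_pole_prod]).

    The formula for [Y] is the formula for [X] applied to the transposed
    systems, which have the same inner product ([H2_inner_tr]). *)

Set Implicit Arguments.
Unset Strict Implicit.
Unset Printing Implicit Defensive.

Import Order.TTheory GRing.Theory Num.Theory.
Import numFieldNormedType.Exports.

Local Open Scope classical_set_scope.
Local Open Scope sesquilinear_scope.
Local Open Scope ring_scope.

(** * Improper integrals of real functions *)

Section RealIntegrals.
Variable R : realType.
Implicit Types (h u : R -> R).
Local Notation mu := (@lebesgue_measure R).

Lemma integrable_oneDsqrV :
  mu.-integrable setT (EFin \o (fun x : R => (1 + x ^+ 2)^-1)).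
Proof.
have cont : continuous (fun x : R => (1 + x ^+ 2)^-1).
  exact: continuous_oneDsqrV.
have ge0 (x : R) : 0 <= (1 + x ^+ 2)^-1.
  by rewrite invr_ge0 addr_ge0 ?ler01 ?sqr_ge0.
apply/integrableP; split.
  by apply/measurable_EFinP; apply: continuous_measurable_fun.
under eq_integral do rewrite gee0_abs ?lee_fin ?ge0//=.
rewrite ge0_symfun_integralT//; last by move=> x /=; rewrite sqrrN.
rewrite -set_itvcy.
have := @integral0y_oneDsqr R; rewrite /oneDsqr => ->.
by rewrite -EFinM ltry.
Qed.

Lemma integrable_oneDsqrV_dominated h (c : R) :
  continuous h -> (forall x, `|h x| <= c * (1 + x ^+ 2)^-1) ->
  mu.-integrable setT (EFin \o h).
Proof.
move=> ch hc.
have := integrableZl measurableT c integrable_oneDsqrV.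
apply: le_integrable => //.
  by apply/measurable_EFinP; apply: continuous_measurable_fun.
move=> x _ /=; rewrite lee_fin; apply: (le_trans (hc x)).
exact: ler_norm.
Qed.

Lemma is_derive_continuous u h :
  (forall x : R, is_derive x 1 u (h x)) -> continuous u.
Proof.
by move=> du x; apply/differentiable_continuous/derivable1_diffP; exact: ex_derive.
Qed.

(** Integrability makes the integrals over the growing symmetric intervals
    converge to the whole integral, so only the limit of [u x - u (- x)] is
    asked for: [u] itself may diverge at both ends, like the logarithm in the
    imaginary part of a simple pole. *)
Lemma Rintegral_symmetric_limit h u (l : R) :
  continuous h -> mu.-integrable setT (EFin \o h) ->
  (forall x : R, is_derive x 1 u (h x)) ->
  u x - u (- x) @[x --> +oo] --> l ->
  \int[mu]_(x in setT) h x = l.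
Proof.
move=> ch ih du ul.
pose I n : set R := `[- (n.+1%:R : R), (n.+1%:R : R)]%classic.
pose f_ n := (EFin \o h) \_ (I n).
have mh : measurable_fun setT (EFin \o h) by case/integrableP: ih.
have mI n : measurable (I n) by exact: measurable_itv.
have mf n : measurable_fun setT (f_ n).
  by apply/(measurable_restrictT _ (mI n)); exact: measurable_funS mh.
have inI x : \forall n \near \oo, I n x.
  near=> n; rewrite /I /= in_itv /= -ler_norml.
  apply: (@le_trans _ _ n%:R); last by rewrite ler_nat.
  by near: n; exact: nbhs_infty_ger.
have [] := @dominated_convergence _ _ _ mu setT measurableT f_ (EFin \o h)
  (fun x => `|(EFin \o h) x|)%E mf mh.
- apply: aeW => x _; apply: cvg_near_cst.
  by apply: filterS (inI x) => n nx; rewrite /f_ patchE mem_set.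
- exact: integrable_abse.
- apply: aeW => x n _; rewrite /f_ patchE; case: ifP => // _.
  by rewrite abse0.
move=> _ _ cvgI.
have EI n : (\int[mu]_x f_ n x = (u n.+1%:R - u (- n.+1%:R))%:E)%E.
  rewrite /f_ -integral_mkcond (@continuous_FTC2 _ h u).
  - by rewrite EFinB.
  - by rewrite -subr_gt0 opprK addr_gt0.
  - exact: continuous_subspaceT.
  - have cu := is_derive_continuous du.
    split; first by move=> x _; exact: ex_derive.
      by apply: cvg_at_right_filter; exact: cu.
    by apply: cvg_at_left_filter; exact: cu.
  - by move=> x _; rewrite derive1E; exact: derive_val.
apply: EFin_inj; rewrite /Rintegral fineK; last exact: integrable_fin_num.
apply: (cvg_unique _ cvgI) => //=.
under eq_fun do rewrite EI.
apply: cvg_EFin; first by near=> n.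
have /= := @cvg_shiftS _ (fun n : nat => u n%:R - u (- n%:R)) (nbhs l).
by move=> ->; apply: cvg_comp ul; exact: cvgr_idn.
Unshelve. all: by end_near. Qed.

End RealIntegrals.

(** * Decaying functions of a real variable *)

Section ComplexValued.
Variable R : realType.
Local Notation C := R[i].
Local Notation Re := (@complex.Re R).
Local Notation Im := (@complex.Im R).
Local Notation mu := (@lebesgue_measure R).
Implicit Types (f g F G : R -> C) (h : R -> R).

Definition sqmod (z : C) : R := Re z ^+ 2 + Im z ^+ 2.

Lemma ReD (z w : C) : Re (z + w) = Re z + Re w.
Proof. by case: z w => [a b] [c d]. Qed.

Lemma ImD (z w : C) : Im (z + w) = Im z + Im w.
Proof. by case: z w => [a b] [c d]. Qed.

Lemma ReM (z w : C) : Re (z * w) = Re z * Re w - Im z * Im w.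
Proof. by case: z w => [a b] [c d]. Qed.

Lemma ImM (z w : C) : Im (z * w) = Re z * Im w + Im z * Re w.
Proof. by case: z w => [a b] [c d]. Qed.

Lemma ReJ (z : C) : Re (Num.conj z) = Re z.
Proof. by case: z. Qed.

Lemma ImJ (z : C) : Im (Num.conj z) = - Im z.
Proof. by case: z. Qed.

Lemma complex_eqP (z w : C) : Re z = Re w -> Im z = Im w -> z = w.
Proof. by case: z w => [a b] [c d] /= -> ->. Qed.

Lemma sqmod_ge0 z : 0 <= sqmod z.
Proof. by rewrite addr_ge0 ?sqr_ge0. Qed.

Lemma sqmodM z w : sqmod (z * w) = sqmod z * sqmod w.
Proof. by rewrite /sqmod ReM ImM; ring. Qed.

Lemma sqmodJ z : sqmod (Num.conj z) = sqmod z.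
Proof. by rewrite /sqmod ReJ ImJ sqrrN. Qed.

Lemma sqmodD z w : sqmod (z + w) <= 2 * (sqmod z + sqmod w).
Proof.
rewrite /sqmod ReD ImD.
have := sqr_ge0 (Re z - Re w); have := sqr_ge0 (Im z - Im w).
by nra.
Qed.

Lemma sqr_Re_le z : Re z ^+ 2 <= sqmod z.
Proof. by rewrite lerDl sqr_ge0. Qed.

Lemma sqr_Im_le z : Im z ^+ 2 <= sqmod z.
Proof. by rewrite lerDr sqr_ge0. Qed.

(** Continuity and [|f x| = O(1 / |x|)], the decay of a strictly proper rational
    function along the imaginary axis. Bounding the square of the modulus
    avoids square roots, and dominates a product of two such functions by an
    integrable function. *)
Definition decay f := [/\ continuous (Re \o f), continuous (Im \o f) &
  exists c : R, forall x, sqmod (f x) <= c * (1 + x ^+ 2)^-1].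

Lemma oneDsqrV_ge0 (x : R) : 0 <= (1 + x ^+ 2)^-1.
Proof. by rewrite invr_ge0 addr_ge0 ?ler01 ?sqr_ge0. Qed.

Lemma oneDsqrV_le1 (x : R) : (1 + x ^+ 2)^-1 <= 1.
Proof. by rewrite invf_le1 ?lerDl ?sqr_ge0// ltr_pwDl ?sqr_ge0. Qed.

Lemma continuous_ReM f g : continuous (Re \o f) -> continuous (Im \o f) ->
  continuous (Re \o g) -> continuous (Im \o g) ->
  continuous (fun x => Re (f x * g x)).
Proof.
move=> rf jf rg jg x; under eq_fun do rewrite ReM.
by apply: cvgB; apply: cvgM; [exact: rf|exact: rg|exact: jf|exact: jg].
Qed.

Lemma continuous_ImM f g : continuous (Re \o f) -> continuous (Im \o f) ->
  continuous (Re \o g) -> continuous (Im \o g) ->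
  continuous (fun x => Im (f x * g x)).
Proof.
move=> rf jf rg jg x; under eq_fun do rewrite ImM.
by apply: cvgD; apply: cvgM; [exact: rf|exact: jg|exact: jf|exact: rg].
Qed.

Lemma decay0 : decay (fun=> 0).
Proof.
split; [exact: cst_continuous|exact: cst_continuous|].
by exists 0 => x; rewrite mul0r /sqmod /= expr0n addr0.
Qed.

Lemma decayD f g : decay f -> decay g -> decay (fun x => f x + g x).
Proof.
move=> [rf jf [c fc]] [rg jg [d gd]]; split.
- move=> x; rewrite /comp; under eq_fun do rewrite ReD.
  by apply: cvgD; [exact: rf|exact: rg].
- move=> x; rewrite /comp; under eq_fun do rewrite ImD.
  by apply: cvgD; [exact: jf|exact: jg].
exists (2 * (c + d)) => x; apply: (le_trans (sqmodD _ _)).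
by have := fc x; have := gd x; lra.
Qed.

Lemma decayZ (a : C) f : decay f -> decay (fun x => a * f x).
Proof.
move=> [rf jf [c fc]]; split.
- apply: (@continuous_ReM (fun=> a)) => //; exact: cst_continuous.
- apply: (@continuous_ImM (fun=> a)) => //; exact: cst_continuous.
exists (sqmod a * c) => x; rewrite sqmodM -mulrA ler_wpM2l ?sqmod_ge0//.
Qed.

Lemma decayJ f : decay f -> decay (fun x => Num.conj (f x)).
Proof.
move=> [rf jf [c fc]]; split.
- by move=> x; rewrite /comp; under eq_fun do rewrite ReJ; exact: rf.
- by move=> x; rewrite /comp; under eq_fun do rewrite ImJ; apply: cvgN; exact: jf.
by exists c => x; rewrite sqmodJ.
Qed.

Lemma decay_sum (I : Type) (r : seq I) (f_ : I -> R -> C) :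
  (forall i, decay (f_ i)) -> decay (fun x => \sum_(i <- r) f_ i x).
Proof.
move=> df; elim: r => [|i r IH].
  by under eq_fun do rewrite big_nil; exact: decay0.
by under eq_fun do rewrite big_cons; exact: decayD.
Qed.

Lemma decayM f g : decay f -> decay g -> decay (fun x => f x * g x).
Proof.
move=> [rf jf [c fc]] [rg jg [d gd]]; split.
- exact: continuous_ReM.
- exact: continuous_ImM.
have c0 : 0 <= c.
  by have := le_trans (sqmod_ge0 _) (fc 0); rewrite expr0n addr0 invr1 mulr1.
exists (c * d) => x; rewrite sqmodM.
apply: (@le_trans _ _ ((c * (1 + x ^+ 2)^-1) * (d * (1 + x ^+ 2)^-1))).
  by apply: ler_pM => //; exact: sqmod_ge0.
have d0 : 0 <= d.
  by have := le_trans (sqmod_ge0 _) (gd 0); rewrite expr0n addr0 invr1 mulr1.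
rewrite mulrACA ler_wpM2l ?mulr_ge0//.
by rewrite ler_piMr ?oneDsqrV_le1 ?oneDsqrV_ge0.
Qed.

Lemma decay_integrable f g : decay f -> decay g ->
  mu.-integrable setT (EFin \o (fun x => Re (f x * g x))) /\
  mu.-integrable setT (EFin \o (fun x => Im (f x * g x))).
Proof.
move=> [rf jf [c fc]] [rg jg [d gd]]; split;
  apply: (@integrable_oneDsqrV_dominated _ _ (c + d)).
- exact: continuous_ReM.
- (* 2 |Re (f g)| <= |f|^2 + |g|^2, by completing squares *)
  move=> x; rewrite ReM ler_norml; have := fc x; have := gd x; rewrite /sqmod.
  set q := (_^-1) => h1 h2.
  have := sqr_ge0 (Re (f x) - Re (g x)); have := sqr_ge0 (Re (f x) + Re (g x)).
  have := sqr_ge0 (Im (f x) - Im (g x)); have := sqr_ge0 (Im (f x) + Im (g x)).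
  by nra.
- exact: continuous_ImM.
- move=> x; rewrite ImM ler_norml; have := fc x; have := gd x; rewrite /sqmod.
  set q := (_^-1) => h1 h2.
  have := sqr_ge0 (Re (f x) - Im (g x)); have := sqr_ge0 (Re (f x) + Im (g x)).
  have := sqr_ge0 (Im (f x) - Re (g x)); have := sqr_ge0 (Im (f x) + Re (g x)).
  by nra.
Qed.

Lemma cvg0_sqr_le h (c : R) :
  (forall x, h x ^+ 2 <= c * (1 + x ^+ 2)^-1) -> h x @[x --> +oo] --> (0 : R).
Proof.
move=> hc; apply/cvgrPdist_lt => e e0.
have c0 : 0 <= c.
  by have := le_trans (sqr_ge0 _) (hc 0); rewrite expr0n addr0 invr1 mulr1.
near=> x.
have x1 : 1 <= x by near: x; apply: nbhs_pinfty_ge; rewrite num_real.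
have xc : c / e ^+ 2 < x.
  by near: x; apply: nbhs_pinfty_gt; rewrite num_real.
rewrite sub0r normrN -(@ltr_pXn2r _ 2) ?nnegrE// ?(ltW e0)//.
rewrite real_normK ?num_real//; apply: (le_lt_trans (hc x)).
rewrite ltr_pdivrMr ?ltr_pwDl ?sqr_ge0//.
rewrite ltr_pdivrMr ?exprn_gt0// mulrC in xc.
apply: (lt_le_trans xc); rewrite ler_wpM2l ?exprn_ge0 ?(ltW e0)//.
by nra.
Unshelve. all: by end_near. Qed.

Lemma decay_cvgy f : decay f ->
  (Re (f x) @[x --> +oo] --> (0 : R)) /\ (Im (f x) @[x --> +oo] --> (0 : R)).
Proof.
move=> [_ _ [c fc]]; split; apply: (@cvg0_sqr_le _ c) => x.
- exact: le_trans (sqr_Re_le _) (fc x).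
- exact: le_trans (sqr_Im_le _) (fc x).
Qed.

Lemma decay_ends_cvg0 f : decay f ->
  (Re (f x) - Re (f (- x)) @[x --> +oo] --> (0 : R)) /\
  (Im (f x) - Im (f (- x)) @[x --> +oo] --> (0 : R)).
Proof.
move=> [_ _ [c fc]]; split; rewrite -[X in _ --> X]subr0;
  apply: cvgB; apply: (@cvg0_sqr_le _ c) => x.
- exact: le_trans (sqr_Re_le _) (fc x).
- by apply: le_trans (sqr_Re_le _) _; have := fc (- x); rewrite sqrrN.
- exact: le_trans (sqr_Im_le _) (fc x).
- by apply: le_trans (sqr_Im_le _) _; have := fc (- x); rewrite sqrrN.
Qed.

End ComplexValued.

(** * Principal values *)

Section PrincipalValue.
Variable R : realType.
Local Notation C := R[i].
Local Notation Re := (@complex.Re R).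
Local Notation Im := (@complex.Im R).
Local Notation mu := (@lebesgue_measure R).
Implicit Types (f g F G : R -> C) (h k : R -> R).

(** The principal value of an integral, by way of an antiderivative: this form
    is linear in [h] without any integrability, and [1 / (i x - l)] is not integrable. *)
Definition pv_real h (l : R) := exists2 u : R -> R,
  forall x : R, is_derive x 1 u (h x) &
  u x - u (- x) @[x --> +oo] --> l.

Definition pv f (L : C) := pv_real (Re \o f) (Re L) /\ pv_real (Im \o f) (Im L).

Lemma pv_realD h k l m :
  pv_real h l -> pv_real k m -> pv_real (fun x => h x + k x) (l + m).
Proof.
move=> [u du ul] [v dv vm]; exists (fun x => u x + v x).
  by move=> x; exact: is_deriveD.
by under eq_fun do rewrite opprD addrACA; exact: cvgD.
Qed.

Lemma pv_realZ (a : R) h l : pv_real h l -> pv_real (fun x => a * h x) (a * l).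
Proof.
move=> [u du ul]; exists (fun x => a * u x).
  by move=> x; exact: is_deriveZ.
by under eq_fun do rewrite -mulrBr; apply: cvgM => //; exact: cvg_cst.
Qed.

Lemma pv_realB h k l m :
  pv_real h l -> pv_real k m -> pv_real (fun x => h x - k x) (l - m).
Proof.
move=> hl km; have := pv_realD hl (pv_realZ (-1) km).
by rewrite mulN1r; under eq_fun do rewrite mulN1r.
Qed.

Lemma pvD f g L M : pv f L -> pv g M -> pv (fun x => f x + g x) (L + M).
Proof.
move=> [rf jf] [rg jg]; rewrite /pv /comp ReD ImD.
under eq_fun do rewrite ReD.
by under [X in pv_real X (Im L + _)]eq_fun do rewrite ImD; split; exact: pv_realD.
Qed.

Lemma pvZ (a : C) f L : pv f L -> pv (fun x => a * f x) (a * L).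
Proof.
move=> [rf jf]; rewrite /pv /comp ReM ImM.
under eq_fun do rewrite ReM.
under [X in pv_real X (Re a * Im L + _)]eq_fun do rewrite ImM; split.
  by apply: pv_realB; exact: pv_realZ.
by apply: pv_realD; exact: pv_realZ.
Qed.

Lemma pvJ f L : pv f L -> pv (fun x => Num.conj (f x)) (Num.conj L).
Proof.
move=> [rf jf]; rewrite /pv /comp ReJ ImJ.
under eq_fun do rewrite ReJ.
under [X in pv_real X (- _)]eq_fun do rewrite ImJ; split => //.
rewrite -[- Im L]mulN1r; under eq_fun do rewrite -mulN1r.
exact: pv_realZ.
Qed.

Lemma pv0 : pv (fun=> 0) 0.
Proof.
by split; exists (fun=> 0) => [x|];
  [exact: is_derive_cst|rewrite subr0; exact: cvg_cst
  |exact: is_derive_cst|rewrite subr0; exact: cvg_cst].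
Qed.

Lemma pv_sum (I : eqType) (r : seq I) (f_ : I -> R -> C) (L_ : I -> C) :
  (forall i, i \in r -> pv (f_ i) (L_ i)) ->
  pv (fun x => \sum_(i <- r) f_ i x) (\sum_(i <- r) L_ i).
Proof.
elim: r => [|i r IH] H.
  by rewrite big_nil; under eq_fun do rewrite big_nil; exact: pv0.
rewrite big_cons; under eq_fun do rewrite big_cons.
by apply: pvD; [apply: H|apply: IH => j jr; apply: H];
  rewrite inE ?eqxx ?jr ?orbT.
Qed.

Lemma cintegral_pv f L :
  continuous (Re \o f) -> continuous (Im \o f) ->
  mu.-integrable setT (EFin \o (Re \o f)) ->
  mu.-integrable setT (EFin \o (Im \o f)) ->
  pv f L -> cintegral f = L.
Proof.
move=> cr ci ir ii [[u du ul] [v dv vl]]; apply: complex_eqP => /=.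
  exact: Rintegral_symmetric_limit du ul.
exact: Rintegral_symmetric_limit dv vl.
Qed.

Definition cderives F f := forall x : R,
  is_derive x (1 : R) (Re \o F) (Re (f x)) /\
  is_derive x (1 : R) (Im \o F) (Im (f x)).

Lemma cderivesM F f G g : cderives F f -> cderives G g ->
  cderives (fun x => F x * G x) (fun x => F x * g x + G x * f x).
Proof.
move=> dF dG x; have [rF jF] := dF x; have [rG jG] := dG x; split.
  rewrite /comp; under eq_fun do rewrite ReM.
  have H := is_deriveB (is_deriveM rF rG) (is_deriveM jF jG).
  apply: (is_derive_eq H); rewrite ReD !ReM /=.
  by rewrite /GRing.scale /=; ring.
rewrite /comp; under eq_fun do rewrite ImM.
have H := is_deriveD (is_deriveM rF jG) (is_deriveM jF rG).
apply: (is_derive_eq H); rewrite ImD !ImM /=.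
by rewrite /GRing.scale /=; ring.
Qed.

Lemma pv_cderives0 F f : decay F -> cderives F f -> pv f 0.
Proof.
move=> /decay_ends_cvg0[rF jF] dF; split.
  by exists (Re \o F) => // x; have [] := dF x.
by exists (Im \o F) => // x; have [] := dF x.
Qed.

Lemma cderivesZ (a : C) F f : cderives F f ->
  cderives (fun x => a * F x) (fun x => a * f x).
Proof.
move=> dF; have da : cderives (fun=> a) (fun=> 0).
  by move=> x; split; exact: is_derive_cst.
have := cderivesM da dF; congr cderives.
by apply/funext => x; rewrite mulr0 addr0.
Qed.

Definition simple_pole (l : C) (w : R) : C := ((0 +i* w)%C - l)^-1.

Lemma simple_poleE (l : C) w : let d := Re l ^+ 2 + (w - Im l) ^+ 2 in
  (Re (simple_pole l w) = - Re l * d^-1) * (Im (simple_pole l w) = (Im l - w) * d^-1).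
Proof.
case: l => a b /=; rewrite /simple_pole /= /GRing.inv /=.
by rewrite !sub0r sqrrN; split; [|rewrite -mulNr opprB].
Qed.

Variable l : C.
Hypothesis stable : Re l < 0.

Let d (w : R) := Re l ^+ 2 + (w - Im l) ^+ 2.

Let d_gt0 w : 0 < d w.
Proof. by rewrite ltr_pwDl ?sqr_ge0// exprn_even_gt0//= lt_eqF. Qed.

Let is_derive_d w : is_derive (w : R) (1 : R) d (2 * (w - Im l)).
Proof.
rewrite /d; apply: trigger_derive; rewrite /GRing.scale /=.
by ring.
Qed.

Let is_derive_dV w :
  is_derive (w : R) (1 : R) (fun w => (d w)^-1) (- (2 * (w - Im l)) * (d w) ^- 2).
Proof.
have H := is_deriveV (lt0r_neq0 (d_gt0 w)) (is_derive_d w).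
by apply: (is_derive_eq H); rewrite /GRing.scale /=; ring.
Qed.

Lemma cderives_simple_pole :
  cderives (simple_pole l) (fun w => (0 -i* 1)%C * simple_pole l w ^+ 2).
Proof.
move=> w; have d0 : d w != 0 by exact: lt0r_neq0.
split.
  have H : is_derive w (1 : R) (fun w => - Re l * (d w)^-1)
     (- Re l * (- (2 * (w - Im l)) * (d w) ^- 2)) by exact: is_deriveZ.
  rewrite (_ : Re \o _ = (fun w => - Re l * (d w)^-1)); last first.
    by apply/funext => x; rewrite /= simple_poleE.
  apply: (is_derive_eq H); rewrite ReM expr2 ImM !simple_poleE /= -/(d w).
  by rewrite mul0r sub0r mulN1r opprK; field.
have H1 : is_derive w (1 : R) (fun w => Im l - w) (-1).
  by apply: trigger_derive; ring.
have H := is_deriveM H1 (is_derive_dV w).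
rewrite (_ : Im \o _ = (fun w => (Im l - w) * (d w)^-1)); last first.
  by apply/funext => x; rewrite /= simple_poleE.
apply: (is_derive_eq H); rewrite ImM expr2 ReM !simple_poleE /= -/(d w).
rewrite /GRing.scale /= /d in d0 *.
by field.
Qed.

Lemma continuous_simple_pole :
  continuous (Re \o simple_pole l) /\ continuous (Im \o simple_pole l).
Proof.
split; first exact: is_derive_continuous (fun x => (cderives_simple_pole x).1).
exact: is_derive_continuous (fun x => (cderives_simple_pole x).2).
Qed.

Lemma decay_simple_pole : decay (simple_pole l).
Proof.
have [cr ci] := continuous_simple_pole; split=> //.
pose a := Re l; pose b := Im l.
(* 1 + w^2 <= c (a^2 + (w - b)^2), from w^2 <= 2 (w - b)^2 + 2 b^2 *)
exists (2 + (1 + 2 * b ^+ 2) / a ^+ 2) => w.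
have a0 : 0 < a ^+ 2 by rewrite exprn_even_gt0//= lt_eqF.
have -> : sqmod (simple_pole l w) = (d w)^-1.
  rewrite /sqmod !simple_poleE -/(d w); have := lt0r_neq0 (d_gt0 w).
  by rewrite /d => d0; field.
rewrite ler_pdivlMr ?ltr_pwDl ?sqr_ge0// mulrC ler_pdivrMr ?d_gt0//.
set t := (X in 2 + X).
have ta : t * a ^+ 2 = 1 + 2 * b ^+ 2 by rewrite /t mulfVK ?lt0r_neq0.
have t0 : 0 <= t by rewrite divr_ge0 ?(ltW a0)//; have := sqr_ge0 b; lra.
rewrite /d -/a -/b.
have := mulr_ge0 t0 (sqr_ge0 (w - b)); have := sqr_ge0 (w - b - b).
by nra.
Qed.

(** The real part is integrated by an arctangent, which contributes [pi]; the
    imaginary part by a logarithm, whose values at the two ends agree in the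
    limit. *)
Lemma pv_simple_pole : pv (simple_pole l) (pi%:C)%C.
Proof.
pose a := - Re l; pose b := Im l.
have a0 : 0 < a by rewrite oppr_gt0.
split.
  exists (fun w => atan ((w - b) / a)) => [w|].
    have H1 : is_derive w (1 : R) (fun w => (w - b) / a) a^-1.
      by apply: trigger_derive; rewrite /GRing.scale /=; ring.
    have H := @is_derive1_comp R atan (fun w => (w - b) / a) w _ _
      (is_derive1_atan ((w - b) / a)) H1.
    apply: (is_derive_eq H); rewrite /= simple_poleE -/a -/b.
    have -> : Re l ^+ 2 = a ^+ 2 by rewrite /a sqrrN.
    have : 0 < a ^+ 2 + (w - b) ^+ 2 by rewrite ltr_pwDl ?sqr_ge0 ?exprn_gt0.
    by move=> /lt0r_neq0 d0; field; rewrite d0 (lt0r_neq0 a0).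
  have lin (c : R) : (w + c) / a @[w --> +oo] --> +oo.
    apply/cvgryPge => A; near=> w; rewrite ler_pdivlMr// -lerBlDr.
    by near: w; apply: nbhs_pinfty_ge; rewrite num_real.
  have -> : Re (pi%:C)%C = pi / 2 + pi / 2 :> R by rewrite /= -splitr.
  have E w : atan ((w - b) / a) - atan ((- w - b) / a) =
             atan ((w + - b) / a) + atan ((w + b) / a).
    by rewrite -atanN -mulNr opprB opprK [b + w]addrC.
  under eq_fun do rewrite E.
  by apply: cvgD; apply: cvg_comp (lin _) (@cvgy_atan R).
exists (fun w => - 2^-1 * ln (d w)) => [w|].
  have H := @is_derive1_comp R (@ln R) d w _ _ (is_derive1_ln (d_gt0 w))
    (is_derive_d w).
  have H2 : is_derive w (1 : R) (fun w => - 2^-1 * ln (d w))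
      (- 2^-1 * ((d w)^-1 * (2 * (w - Im l)))) by exact: is_deriveZ.
  apply: (is_derive_eq H2); rewrite /= simple_poleE -/(d w).
  have := lt0r_neq0 (d_gt0 w); rewrite /d => d0.
  by field.
have E w : - 2^-1 * ln (d w) - - 2^-1 * ln (d (- w)) = 2^-1 * ln (d (- w) / d w).
  by rewrite ln_div ?posrE ?d_gt0//; ring.
under eq_fun do rewrite E.
rewrite [Im _]/= -(mulr0 2^-1) -(@ln1 R).
apply: cvgM; first exact: cvg_cst.
have ratio : d (- w) / d w @[w --> +oo] --> (1 : R); last first.
  apply: (@cvg_comp _ _ _ (fun w => d (- w) / d w) (@ln R) _ (nbhs (1 : R))) => //.
  by apply: continuous_ln; exact: ltr01.
(* The ratio is a combination of 1 and the two parts of the pole itself, which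
   decay. *)
have [r0 i0] := decay_cvgy decay_simple_pole.
have {}E w : d (- w) / d w =
    1 + (- (4 * b) * Im (simple_pole l w) + 4 * b ^+ 2 / a * Re (simple_pole l w)).
  rewrite !simple_poleE -/(d w) -/a -/b; have := lt0r_neq0 (d_gt0 w).
  have al : Re l ^+ 2 = a ^+ 2 by rewrite /a sqrrN.
  by rewrite /d al -/b => d0; field; rewrite d0 (lt0r_neq0 a0).
under eq_fun do rewrite E.
suff : 1 + (- (4 * b) * Im (simple_pole l w) + 4 * b ^+ 2 / a * Re (simple_pole l w))
    @[w --> +oo] --> 1 + (- (4 * b) * 0 + 4 * b ^+ 2 / a * 0) by rewrite !mulr0 !addr0.
by apply: cvgD; [|apply: cvgD; apply: cvgM => //]; exact: cvg_cst.
Unshelve. all: by end_near. Qed.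

End PrincipalValue.

(** * Products of simple poles *)

Section PoleProducts.
Variable R : realType.
Local Notation C := R[i].
Local Notation Re := (@complex.Re R).
Implicit Types (r : seq C) (l z : C) (w : R).

Definition stable_pole : pred C := [pred l | Re l < 0].

Definition pole_prod r z : C := \prod_(l <- r) (z - l)^-1.

Local Notation on_axis f := (fun w : R => f (w *i)%C).

Lemma axis_neq_stable l w : stable_pole l -> (w *i)%C - l != 0.
Proof.
by move=> sl; apply: contraTneq sl => /subr0_eq <-; rewrite /stable_pole /= ltxx.
Qed.

Lemma cderives_simple_poleX l n : stable_pole l ->
  cderives (fun w => simple_pole l w ^+ n.+1)
    (fun w => n.+1%:R * (0 -i* 1)%C * simple_pole l w ^+ n.+2).
Proof.
move=> sl; elim: n => [|n IH].
  have := cderives_simple_pole sl; congr cderives.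
  by apply/funext => w; ring.
have := cderivesM (cderives_simple_pole sl) IH.
congr cderives; apply/funext => w.
by rewrite -[n.+2%:R]natr1 !exprS; ring.
Qed.

Lemma decay_pole_prod l r :
  all stable_pole (l :: r) -> decay (on_axis (pole_prod (l :: r))).
Proof.
elim: r l => [|l' r IH] l /= /andP[sl sr].
  have := decay_simple_pole sl; congr decay.
  by apply/funext => w; rewrite /pole_prod big_seq1.
have := decayM (decay_simple_pole sl) (IH _ sr); congr decay.
by apply/funext => w; rewrite /pole_prod (big_cons _ _ l).
Qed.

(** Two distinct poles are separated by partial fractions, which lowers the
    number of factors and, in the case of two factors, subtracts [pi] from
    [pi]; a higher power of a single pole has an antiderivative that vanishes
    at infinity. *)
Lemma pv_pole_prod r : r != [::] -> all stable_pole r ->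
  pv (on_axis (pole_prod r)) (if size r == 1%N then pi%:C%C else 0).
Proof.
have [n] := ubnP (size r); elim: n r => // n IH [|a r] // szr _ sar.
case: r szr sar => [|b r] szr sar.
  have /= /andP[sa _] := sar.
  have := pv_simple_pole sa; congr pv.
  by apply/funext => w; rewrite /pole_prod big_seq1.
rewrite [_ == _]/=.
have /andP[sa sbr] : stable_pole a && all stable_pole (b :: r) by [].
have [/all_pred1P eqr|/allPn[c cr ca]] := boolP (all (pred1 a) (b :: r)).
  rewrite eqr /=; set k := size r.
  have prod_nseq m w : pole_prod (nseq m a) (w *i)%C = simple_pole a w ^+ m.
    rewrite /pole_prod; elim: m => [|m IHm]; first by rewrite big_nil.
    by rewrite big_cons IHm exprS.
  (* The factor i / (k + 1) compensates the derivative - i (k + 1) of the power. *)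
  pose F w := (0 +i* k.+1%:R^-1)%C * simple_pole a w ^+ k.+1.
  have dF : decay F.
    apply: decayZ.
    have : all stable_pole (nseq k.+1 a) by rewrite all_nseq sa orbT.
    move=> /decay_pole_prod; congr decay; apply/funext => w.
    exact: (prod_nseq k.+1).
  apply: (pv_cderives0 dF).
  have := cderivesZ (0 +i* k.+1%:R^-1)%C (cderives_simple_poleX k sa).
  congr cderives; apply/funext => w.
  rewrite (prod_nseq k.+2) mulrA -[RHS]mul1r; congr (_ * _).
  have -> : (k.+1%:R : C) = ((k.+1%:R : R)%:C)%C by rewrite rmorph_nat.
  have k0 : (k.+1%:R : R) != 0 by rewrite pnatr_eq0.
  by apply: complex_eqP; rewrite !(ReM, ImM) /=; field.
have sc : stable_pole c by exact: (allP sbr).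
have pr := perm_to_rem cr.
pose s := rem c (b :: r).
have sz : size (b :: r) = (size s).+1 by rewrite (perm_size pr).
have ss : all stable_pole s.
  by move: sbr; rewrite (perm_all _ pr) /= => /andP[].
have lt_n : ((size s).+1 < n)%N by rewrite -sz -ltnS.
have P1 := IH (a :: s) lt_n isT.
have P2 := IH (c :: s) lt_n isT.
rewrite /= sa ss in P1; rewrite /= sc ss in P2.
have := pvZ (a - c)^-1 (pvD (P1 isT) (pvZ (-1) (P2 isT))).
rewrite mulN1r subrr mulr0; congr pv; apply/funext => w.
rewrite /pole_prod big_cons (big_cons _ _ c) (big_cons _ _ a) (perm_big _ pr).
rewrite (big_cons _ _ c) /=.
have na := axis_neq_stable w sa; have nc := axis_neq_stable w sc.
by field; rewrite nc na subr_eq0 eq_sym.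
Qed.

(** * Functions vanishing at infinity *)

(** The scalar form of strict properness. *)
Definition vanishing (f : C -> C) := forall e : R, 0 < e ->
  exists r : R, forall s : C, (r%:C)%C < `|s| -> `|f s| < (e%:C)%C.

Lemma vanishingD f g : vanishing f -> vanishing g ->
  vanishing (fun s => f s + g s).
Proof.
move=> vf vg e e0; have e20 : 0 < e / 2 by rewrite divr_gt0.
have [r hr] := vf _ e20; have [t ht] := vg _ e20.
exists (Num.max r t) => s ms; apply: (le_lt_trans (ler_normD _ _)).
have -> : (e%:C)%C = ((e / 2)%:C + (e / 2)%:C)%C.
  by rewrite -rmorphD -splitr.
apply: ltrD; [apply: hr|apply: ht]; apply: le_lt_trans ms; rewrite lecR.
  by rewrite le_max lexx.
by rewrite le_max lexx orbT.
Qed.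

Lemma vanishing0 : vanishing (fun=> 0).
Proof. by move=> e e0; exists 0 => s _; rewrite normr0 ltcR. Qed.

Lemma vanishing_sum (I : Type) (r : seq I) (f_ : I -> C -> C) :
  (forall i, vanishing (f_ i)) -> vanishing (fun s => \sum_(i <- r) f_ i s).
Proof.
move=> vf; elim: r => [|i r IH].
  by under eq_fun do rewrite big_nil; exact: vanishing0.
by under eq_fun do rewrite big_cons; exact: vanishingD.
Qed.

Lemma normC_real (z : C) : `|z| = ((Normc.normc z)%:C)%C.
Proof. by []. Qed.

Lemma vanishingZ (a : C) f : vanishing f -> vanishing (fun s => a * f s).
Proof.
move=> vf e e0.
have na : 0 <= Normc.normc a by have := normr_ge0 a; rewrite normC_real lecR.
have ea : 0 < e / (1 + Normc.normc a) by rewrite divr_gt0// ltr_pwDl.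
have [r hr] := vf _ ea; exists r => s /hr; rewrite normrM !normC_real.
rewrite -rmorphM !ltcR ltr_pdivlMr ?ltr_pwDl// => hs; apply: le_lt_trans hs.
have : 0 <= Normc.normc (f s) by have := normr_ge0 (f s); rewrite normC_real lecR.
by nra.
Qed.

Lemma vanishingM f g : vanishing f -> vanishing g ->
  vanishing (fun s => f s * g s).
Proof.
move=> vf vg e e0.
have [r hr] := vf _ e0; have [t ht] := vg _ (@ltr01 R).
exists (Num.max r t) => s ms; rewrite normrM -[(e%:C)%C]mulr1.
apply: ltr_pM => //; [apply: hr|apply: ht]; apply: le_lt_trans ms; rewrite lecR.
  by rewrite le_max lexx.
by rewrite le_max lexx orbT.
Qed.

Lemma vanishing_pole l : vanishing (fun s => (s - l)^-1).
Proof.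
move=> e e0; exists (e^-1 + Normc.normc l) => s hs.
have lt1 : ((e^-1)%:C)%C < `|s - l|.
  have := lerB_dist s l; apply: lt_le_trans.
  by rewrite ltrBrDr normC_real -rmorphD.
rewrite normfV -[(e%:C)%C]invrK ltf_pV2 ?posrE -?fmorphV//.
  by apply: lt_trans lt1; rewrite ltcR invr_gt0.
by rewrite ltcR invr_gt0.
Qed.

Lemma vanishing_pole_prod l r : vanishing (pole_prod (l :: r)).
Proof.
elim: r l => [|l' r IH] l.
  have := vanishing_pole l; congr vanishing.
  by apply/funext => s; rewrite /pole_prod big_seq1.
have := vanishingM (vanishing_pole l) (IH l'); congr vanishing.
by apply/funext => s; rewrite /pole_prod (big_cons _ _ l).
Qed.

Lemma normc_ge0 (z : C) : 0 <= Normc.normc z.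
Proof. by have := normr_ge0 z; rewrite normC_real lecR. Qed.

Lemma eventually_notin r :
  exists t : R, forall s : C, (t%:C)%C < `|s| -> s \notin r.
Proof.
exists (\sum_(l <- r) Normc.normc l) => s; rewrite normC_real ltcR.
apply: contraTN => sr; rewrite -leNgt (big_rem _ sr) /= lerDl.
by apply: sumr_ge0 => l _; exact: normc_ge0.
Qed.

Lemma vanishing_eventually f g :
  (exists t : R, forall s : C, (t%:C)%C < `|s| -> g s = f s) ->
  vanishing f -> vanishing g.
Proof.
move=> [t fg] vf e e0; have [r hr] := vf e e0.
exists (Num.max t r) => s ms; rewrite fg.
  by apply: hr; apply: le_lt_trans ms; rewrite lecR le_max lexx orbT.
by apply: le_lt_trans ms; rewrite lecR le_max lexx.
Qed.

(** A nonconstant polynomial takes every value, in particular a value larger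
    than its bounds near infinity and on the remaining disc. *)
Lemma vanishing_horner (q : {poly C}) : vanishing (horner q) -> q = 0.
Proof.
move=> vq; have [r hr] := vq _ (@ltr01 R).
have [sz|sz] := leqP (size q) 1%N.
  rewrite (size1_polyC sz) in vq *.
  have [->//|q0] := eqVneq q`_0 0.
  have e0 : 0 < Normc.normc q`_0 by rewrite -ltcR -normC_real normr_gt0.
  have [t ht] := vq _ e0.
  have : (t%:C)%C < `|((`|t| + 1)%:C)%C : C|.
    rewrite normC_real ltcR /Normc.normc /= expr0n /= addr0 sqrtr_sqr.
    rewrite ger0_norm ?addr_ge0//.
    by apply: (le_lt_trans (ler_norm t)); rewrite ltrDl.
  by move=> /ht; rewrite hornerC normC_real ltxx.
exfalso; pose rho := Num.max r 0.
have rho0 : 0 <= rho by rewrite le_max lexx orbT.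
pose M := \sum_(i < size q) Normc.normc q`_i * rho ^+ i.
have M0 : 0 <= M.
  by apply: sumr_ge0 => i _; rewrite mulr_ge0 ?normc_ge0 ?exprn_ge0.
pose c : C := ((M + 1)%:C)%C.
have cM : Normc.normc c = M + 1.
  by rewrite /Normc.normc /= expr0n /= addr0 sqrtr_sqr ger0_norm ?addr_ge0.
have /closed_rootP[s] : size (q - c%:P) != 1%N.
  rewrite size_polyDl ?(gtn_eqF sz)// size_polyN.
  exact: leq_ltn_trans (size_polyC_leq1 _) sz.
rewrite rootE !hornerE subr_eq0 => /eqP qs.
have [sr|rs] := ltP r (Normc.normc s).
  have := hr s; rewrite qs !normC_real !ltcR cM => /(_ sr).
  by rewrite ltNge lerDr M0.
have : Normc.normc q.[s] <= M.
  rewrite -lecR -normC_real horner_coef (le_trans (ler_norm_sum _ _ _))//.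
  rewrite /M rmorph_sum; apply: ler_sum => i _.
  rewrite normrM normrX !normC_real -rmorphXn -rmorphM lecR.
  rewrite ler_wpM2l ?normc_ge0// lerXn2r ?nnegrE ?normc_ge0//.
  by rewrite le_max rs.
by rewrite qs cM leNgt ltrDl ltr01.
Qed.

End PoleProducts.

(** * Resolvents of stable matrices and the Sylvester equation *)

Section StableMatrices.
Variable R : realType.
Local Notation C := R[i].
Local Notation Re := (@complex.Re R).

Definition stable_mx n (J : 'M[C]_n) :=
  forall s : C, \det (s%:M - J) = 0 -> Re s < 0.

(** The Newton basis polynomials for the nodes [r], evaluated at [J]. *)
Definition newton_mx n (r : seq C) (J : 'M[C]_n) : 'M[C]_n :=
  \prod_(l <- r) (J - l%:M).

Lemma horner_det n (M : 'M[{poly C}]_n) s :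
  (\det M).[s] = \det (map_mx (horner_eval s) M).
Proof. by rewrite -horner_evalE -det_map_mx. Qed.

Lemma horner_char_poly n (J : 'M[C]_n) s : (char_poly J).[s] = \det (s%:M - J).
Proof.
rewrite /char_poly horner_det; congr (\det _); apply/matrixP => i j.
by rewrite !mxE /horner_eval !(hornerE, hornerMn).
Qed.

(** Cayley-Hamilton, with the characteristic polynomial split into linear
    factors. *)
Lemma annihilating_roots n (J : 'M[C]_n) : exists r : seq C,
  [/\ size r = n, forall l, l \in r -> \det (l%:M - J) = 0 &
      newton_mx r J = 0].
Proof.
have [r def_r] := closed_field_poly_normal (char_poly J).
have /eqP mon : lead_coef (char_poly J) == 1 by rewrite -monicE char_poly_monic.
rewrite mon scale1r in def_r.
exists r; split.
- have := size_char_poly J; rewrite def_r size_prod_XsubC.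
  by case.
- by move=> l lr; apply/eqP; rewrite -horner_char_poly def_r -rootE root_prod_XsubC.
case: n J def_r {mon} => [|n] J def_r; first by rewrite flatmx0.
have := Cayley_Hamilton J; rewrite def_r rmorph_prod /= => <-.
apply: eq_bigr => l _.
by rewrite rmorphB /= horner_mx_X horner_mx_C.
Qed.

(** A partial fraction expansion of the resolvent that needs no eigenvectors and
    is indifferent to multiplicities. Writing
    [s - J = (s - l) - (J - l)] for the next node [l] makes the sum telescope;
    the remainder vanishes once [r] lists all eigenvalues, by
    Cayley-Hamilton. *)
Lemma newton_expansion n (J : 'M[C]_n) (r : seq C) s : s \notin r ->
  (\sum_(k < size r) pole_prod (take k.+1 r) s *: newton_mx (take k r) J)
    *m (s%:M - J) = 1%:M - pole_prod r s *: newton_mx r J.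
Proof.
move=> sr; pose t k := pole_prod (take k r) s *: newton_mx (take k r) J.
rewrite mulmx_suml.
under eq_bigr => k _.
  have -> : pole_prod (take k.+1 r) s *: newton_mx (take k r) J *m (s%:M - J)
      = - (t k.+1 - t k).
    have kr := ltn_ord k.
    have sk : s - nth 0 r k != 0.
      by rewrite subr_eq0; apply: contraNneq sr => ->; rewrite mem_nth.
    rewrite opprB /t (take_nth 0 kr) /pole_prod /newton_mx.
    rewrite -!cats1 !big_cat !big_seq1 /=.
    set p := \prod_(_ <- _) (_ - _)^-1; set M := \prod_(_ <- _) (_ - _%:M).
    have -> : s%:M - J = (s - nth 0 r k)%:M - (J - (nth 0 r k)%:M).
      by rewrite raddfB /= opprB addrA subrK.
    rewrite mulmxBr -!scalemxAl mul_mx_scalar scalerA -mulrA mulVf// mulr1.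
    by [].
  over.
rewrite sumrN -(big_mkord xpredT (fun k => t k.+1 - t k)) telescope_sumr//.
rewrite opprB /t take0 take_size /pole_prod /newton_mx !big_nil scale1r.
by [].
Qed.

(** The normalization [P 0 = 1] is what matters: only the term with a single
    pole has a nonzero principal value, and its coefficient is the identity. *)
Lemma stable_resolvent n (J : 'M[C]_n) : stable_mx J ->
  exists (r : seq C) (P : nat -> 'M[C]_n), [/\ size r = n, all (@stable_pole R) r,
    P 0%N = 1%:M & forall s, s \notin r -> s%:M - J \in unitmx /\
    invmx (s%:M - J) = \sum_(k < size r) pole_prod (take k.+1 r) s *: P k].
Proof.
move=> sJ; have [r [szr rootr annr]] := annihilating_roots J.
exists r, (fun k => newton_mx (take k r) J); split => //.
- by apply/allP => l /rootr /sJ.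
- by rewrite take0 /newton_mx big_nil.
move=> s sr; have := newton_expansion J sr; rewrite annr scaler0 subr0 => E.
have [_ u] := mulmx1_unit E; split=> //.
by rewrite -[RHS]mulmx1 -(mulmxV u) mulmxA E mul1mx.
Qed.

Section Resolvent.
Variables (n : nat) (J : 'M[C]_n).
Hypothesis sJ : stable_mx J.

(** Every scalar built linearly from the resolvent is [\tr (invmx (s%:M - J) *m M)]
    for some [M], so the analytic facts are stated for traces. *)
Lemma resolvent_traceE (M : 'M[C]_n) : exists (r : seq C) (a : nat -> C),
  [/\ size r = n, all (@stable_pole R) r, a 0%N = \tr M &
  forall s, s \notin r -> \tr (invmx (s%:M - J) *m M) =
    \sum_(k < size r) a k * pole_prod (take k.+1 r) s].
Proof.
have [r [P [szr sr P0 invE]]] := stable_resolvent sJ.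
exists r, (fun k => \tr (P k *m M)); split => //; first by rewrite P0 mul1mx.
move=> s /invE[_ ->]; rewrite mulmx_suml raddf_sum; apply: eq_bigr => k _ /=.
by rewrite -scalemxAl mxtraceZ mulrC.
Qed.

Lemma axis_notin_stable (r : seq C) (w : R) :
  all (@stable_pole R) r -> (w *i)%C \notin r.
Proof. by move=> /allP sr; apply/negP => /sr; rewrite /stable_pole /= ltxx. Qed.

Lemma stable_mx_unit s : 0 <= Re s -> s%:M - J \in unitmx.
Proof.
by move=> s0; rewrite unitmxE unitfE; apply/eqP => /sJ; rewrite ltNge s0.
Qed.

Let all_take (r : seq C) k : all (@stable_pole R) r -> all (@stable_pole R) (take k r).
Proof. by move=> /allP sr; apply/allP => l /mem_take /sr. Qed.

Lemma decay_resolvent (M : 'M[C]_n) :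
  decay (fun w : R => \tr (invmx ((w *i)%C%:M - J) *m M)).
Proof.
have [r [a [_ sr _ trE]]] := resolvent_traceE M.
under eq_fun do rewrite trE ?axis_notin_stable//.
apply: decay_sum => k; apply: decayZ.
case: r sr k {trE} => [|l r] sr [k lt_k] //.
by apply: decay_pole_prod; exact: (@all_take (l :: r) k.+1).
Qed.

Lemma pv_resolvent (M : 'M[C]_n) :
  pv (fun w : R => \tr (invmx ((w *i)%C%:M - J) *m M)) (pi%:C%C * \tr M).
Proof.
have [r [a [szr sr a0 trE]]] := resolvent_traceE M.
under eq_fun do rewrite trE ?axis_notin_stable//.
have -> : pi%:C%C * \tr M =
    \sum_(k < size r) a k * (if k.+1 == 1%N then pi%:C%C else 0).
  case: r szr {sr trE} => [|l r] szr /=.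
    rewrite big_ord0; suff -> : M = 0 by rewrite mxtrace0 mulr0.
    by move: M {a0}; rewrite -szr => M; rewrite [LHS]flatmx0 [RHS]flatmx0.
  rewrite big_ord_recl /= a0 mulrC big1 ?addr0// => k _.
  by rewrite mulr0.
apply: pv_sum => k _; apply: pvZ.
case: r sr k {szr trE} => [|l r] sr [k lt_k] //.
have := pv_pole_prod (r := take k.+1 (l :: r)) isT (all_take _ sr).
rewrite size_take_min (minn_idPl _)//.
Qed.

Lemma vanishing_resolvent (M : 'M[C]_n) :
  vanishing (fun s => \tr (invmx (s%:M - J) *m M)).
Proof.
have [r [a [szr sr a0 trE]]] := resolvent_traceE M.
have [t ht] := eventually_notin r.
apply: (vanishing_eventually (f := fun s =>
    \sum_(k < size r) a k * pole_prod (take k.+1 r) s)).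
  by exists t => s /ht; exact: trE.
apply: vanishing_sum => k; apply: vanishingZ.
case: r {szr sr trE ht} k => [|l r] [k lt_k] //.
exact: vanishing_pole_prod.
Qed.

End Resolvent.

Section Sylvester.
Variables (a b : nat) (J : 'M[C]_a) (K : 'M[C]_b).
Hypotheses (sJ : stable_mx J) (sK : stable_mx K).

(** [Z] intertwines [J] and [- K], so the characteristic polynomial of [J]
    annihilates [Z] on the left and acts on the right as a product of invertible
    matrices: no eigenvalue of [J] is one of [- K], their real parts having
    opposite signs. *)
Lemma sylvester_inj (Z : 'M[C]_(a, b)) : J *m Z + Z *m K = 0 -> Z = 0.
Proof.
move=> JZ; have [r [_ rootr annr]] := annihilating_roots J.
have comm l : (J - l%:M) *m Z = Z *m ((- l)%:M - K).
  rewrite mulmxBl mulmxBr mul_scalar_mx mul_mx_scalar scaleNr.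
  by move/eqP: JZ; rewrite addr_eq0 => /eqP ->; rewrite addrC.
have prodE (t : seq C) :
    newton_mx t J *m Z = Z *m \prod_(l <- t) ((- l)%:M - K).
  elim: t => [|l t IH]; first by rewrite /newton_mx !big_nil mul1mx mulmx1.
  by rewrite /newton_mx !big_cons -!mulmxE -mulmxA IH mulmxA comm mulmxA.
have unit_prod (t : seq C) : {subset t <= r} ->
    \prod_(l <- t) ((- l)%:M - K) \in unitmx.
  elim: t => [|l t IH] tr; first by rewrite big_nil unitmx1.
  rewrite big_cons -mulmxE unitmx_mul IH ?andbT; last first.
    by move=> x xt; apply: tr; rewrite inE xt orbT.
  rewrite stable_mx_unit//; have : Re l < 0.
    by apply/sJ/rootr/tr; rewrite inE eqxx.
  by case: (l) => u v /= /ltW; rewrite oppr_ge0.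
have := prodE r; rewrite annr mul0mx => /esym ZQ0.
by rewrite -[Z](mulmxK (unit_prod r (fun x => id))) ZQ0 mul0mx.
Qed.

(** An injective linear operator on a finite-dimensional space is onto. *)
Lemma sylvester_solve (M : 'M[C]_(a, b)) : exists Z, J *m Z + Z *m K + M = 0.
Proof.
pose S := lin_mulmx J + lin_mulmxr K : 'M[C]_(a * b).
have SE Z : mxvec Z *m S = mxvec (J *m Z + Z *m K).
  by rewrite mulmxDr !mul_vec_lin /= -linearD.
have /row_freeP[T ST] : row_free S.
  apply: inj_row_free => v; rewrite -[v]vec_mxK SE => /eqP.
  rewrite mxvec_eq0 => /eqP /sylvester_inj ->; exact: linear0.
have TS : T *m S = 1%:M by exact: mulmx1C.
exists (vec_mx (mxvec (- M) *m T)).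
suff -> : J *m vec_mx (mxvec (- M) *m T) + vec_mx (mxvec (- M) *m T) *m K = - M.
  by rewrite addNr.
by apply: (can_inj mxvecK); rewrite -SE vec_mxK -mulmxA TS mulmx1.
Qed.

End Sylvester.

Lemma stable_mx_adj n (J : 'M[C]_n) : stable_mx J -> stable_mx (J ^t*).
Proof.
move=> sJ s; rewrite -[s%:M - _]trmxK det_tr => ds.
rewrite -ReJ; apply: sJ; apply: (fmorph_inj (@Num.conj _)).
rewrite rmorph0 -det_map_mx -ds; congr (\det _).
apply/matrixP => i j; rewrite !mxE rmorphB rmorphMn /= conjCK.
by rewrite eq_sym.
Qed.

End StableMatrices.

(** * Inner product of two proper transfer functions *)

Section ProperInner.
Variable R : realType.
Local Notation C := R[i].
Local Notation Re := (@complex.Re R).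
Local Notation Im := (@complex.Im R).
Local Notation mu := (@lebesgue_measure R).

Lemma adj_mul m n p (M : 'M[C]_(m, n)) (N : 'M[C]_(n, p)) :
  (M *m N)^t* = N^t* *m M^t*.
Proof. by rewrite trmx_mul map_mxM. Qed.

Lemma adjK m n (M : 'M[C]_(m, n)) : (M ^t*) ^t* = M.
Proof. by apply/matrixP => i j; rewrite !mxE conjCK. Qed.

Lemma mxtrace_adj n (M : 'M[C]_n) : \tr (M ^t*) = Num.conj (\tr M).
Proof. by rewrite trace_map_mx mxtrace_tr. Qed.

Lemma mxtrace_delta m n (M : 'M[C]_(m, n)) i j : \tr (M *m delta_mx j i) = M i j.
Proof.
rewrite /mxtrace (bigD1 i)//= big1 ?addr0 => [|k ki].
  rewrite !mxE (bigD1 j)//= big1 ?addr0 => [|k kj].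
    by rewrite !mxE !eqxx mulr1.
  by rewrite !mxE (negPf kj) mulr0.
by rewrite !mxE big1// => l _; rewrite !mxE (negPf ki) andbF mulr0.
Qed.

Definition proper_transfer n m p (J : 'M[C]_n) (B : 'M[C]_(n, m))
  (D : 'M[C]_(p, n)) (s : C) : 'M[C]_(p, m) := D *m invmx (s%:M - J) *m B.

Lemma proper_transfer_entry n m p (J : 'M[C]_n) (B : 'M[C]_(n, m))
  (D : 'M[C]_(p, n)) s i j :
  proper_transfer J B D s i j =
  \tr (invmx (s%:M - J) *m (B *m delta_mx j i *m D)).
Proof.
by rewrite -mxtrace_delta /proper_transfer -!mulmxA mxtrace_mulC -!mulmxA.
Qed.

Definition cintegrable (f : R -> C) :=
  mu.-integrable setT (EFin \o (Re \o f)) /\ mu.-integrable setT (EFin \o (Im \o f)).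

Lemma cintegrableD f g : cintegrable f -> cintegrable g ->
  cintegrable (fun x => f x + g x).
Proof.
move=> [rf jf] [rg jg]; split.
  have := integrableD measurableT rf rg; congr (_.-integrable _ _).
  by apply/funext => x /=; rewrite ReD.
have := integrableD measurableT jf jg; congr (_.-integrable _ _).
by apply/funext => x /=; rewrite ImD.
Qed.

Lemma cintegrable_sum (I : Type) (r : seq I) (f_ : I -> R -> C) :
  (forall i, cintegrable (f_ i)) -> cintegrable (fun x => \sum_(i <- r) f_ i x).
Proof.
move=> cf; elim: r => [|i r IH].
  under eq_fun do rewrite big_nil.
  by split; apply: (eq_integrable measurableT (cst 0%E)) => //; exact: integrable0.
by under eq_fun do rewrite big_cons; exact: cintegrableD.
Qed.

Lemma cintegrable_decayM f g : decay f -> decay g ->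
  cintegrable (fun x => f x * g x).
Proof. by move=> df dg; have [] := decay_integrable df dg; split. Qed.

Section TwoSystems.
Variables (n k m p : nat) (J : 'M[C]_n) (K : 'M[C]_k).
Variables (B : 'M[C]_(n, m)) (D : 'M[C]_(p, n)).
Variables (L : 'M[C]_(k, m)) (F : 'M[C]_(p, k)).
Hypotheses (sJ : stable_mx J) (sK : stable_mx K).

Let GJ (w : R) := proper_transfer J B D (w *i)%C.
Let GK (w : R) := proper_transfer K L F (w *i)%C.

Lemma cintegrable_inner : cintegrable (fun w => \tr (GJ w *m (GK w) ^t*)).
Proof.
have -> : (fun w => \tr (GJ w *m (GK w) ^t*)) =
    (fun w => \sum_(i < p) \sum_(j < m) GJ w i j * Num.conj (GK w i j)).
  apply/funext => w; apply: eq_bigr => i _; rewrite !mxE.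
  by apply: eq_bigr => j _; rewrite !mxE.
apply: cintegrable_sum => i; apply: cintegrable_sum => j.
apply: cintegrable_decayM.
  rewrite /GJ; under eq_fun do rewrite proper_transfer_entry.
  exact: decay_resolvent.
rewrite /GK; under eq_fun do rewrite proper_transfer_entry.
by apply: decayJ; exact: decay_resolvent.
Qed.

Variable Z : 'M[C]_(n, k).
Hypothesis eqZ : J *m Z + Z *m K ^t* + B *m L ^t* = 0.

(** On the imaginary axis the Sylvester equation reads
    [B L^H = (s - J) Z + Z (s - K)^H], which decouples the two resolvents. *)
Lemma inner_split w : \tr (GJ w *m (GK w) ^t*) =
  \tr (invmx ((w *i)%C%:M - J) *m (Z *m F ^t* *m D)) +
  Num.conj (\tr (invmx ((w *i)%C%:M - K) *m (Z ^t* *m D ^t* *m F))).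
Proof.
pose s := (w *i)%C : C.
have uJ : s%:M - J \in unitmx by exact: stable_mx_unit.
have uK : s%:M - K \in unitmx by exact: stable_mx_unit.
have uKa : (s%:M - K)^t* \in unitmx by rewrite map_unitmx unitmx_tr.
have adjK_s : (s%:M - K)^t* = - s%:M - K ^t*.
  apply/matrixP => i j; rewrite !mxE rmorphB rmorphMn /= eq_sym -mulNrn.
  by congr (_ *+ _ - _); apply: complex_eqP; rewrite /= ?oppr0.
have BL : B *m L ^t* = (s%:M - J) *m Z + Z *m (s%:M - K)^t*.
  rewrite adjK_s mulmxBl mulmxBr mulmxN mul_scalar_mx mul_mx_scalar.
  move/eqP: eqZ; rewrite addrC addr_eq0 => /eqP ->.
  by rewrite opprD addrACA subrr add0r.
have RBLR : invmx (s%:M - J) *m (B *m L ^t*) *m invmx ((s%:M - K)^t*) =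
    Z *m invmx ((s%:M - K)^t*) + invmx (s%:M - J) *m Z.
  by rewrite BL mulmxDr mulKmx// mulmxDl -!mulmxA mulmxV// mulmx1.
have -> : GJ w *m (GK w) ^t* =
    D *m (Z *m invmx ((s%:M - K)^t*) + invmx (s%:M - J) *m Z) *m F ^t*.
  rewrite -RBLR /GJ /GK /proper_transfer -/s !adj_mul -map_invmx trmx_inv.
  by rewrite !mulmxA.
rewrite mulmxDr mulmxDl mxtraceD addrC; congr (_ + _).
  by rewrite -!mulmxA mxtrace_mulC !mulmxA.
rewrite -mxtrace_adj !adj_mul !adjK -map_invmx trmx_inv.
by rewrite -!mulmxA [RHS]mxtrace_mulC -!mulmxA.
Qed.

(** The product of the two transfer functions is integrable although the two
    summands of [inner_split] need not be; each of them contributes one half of the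
    value, as a principal value. *)
Lemma H2_inner_proper (G H : C -> 'M[C]_(p, m)) :
  (forall w : R, G (w *i)%C = GJ w) -> (forall w : R, H (w *i)%C = GK w) ->
  H2_inner G H = \tr (D *m Z *m F ^t*).
Proof.
move=> EG EH; rewrite /H2_inner.
under [X in cintegral X]eq_fun do rewrite EG EH.
have [ir ii] := cintegrable_inner.
have dec : decay (fun w => \tr (GJ w *m (GK w) ^t*)).
  under eq_fun do rewrite inner_split.
  by apply: decayD; [|apply: decayJ]; exact: decay_resolvent.
have lim : pv (fun w => \tr (GJ w *m (GK w) ^t*))
    (((2 * pi)%:C)%C * \tr (D *m Z *m F ^t*)).
  under eq_fun do rewrite inner_split.
  have := pvD (pv_resolvent sJ (Z *m F ^t* *m D))
    (pvJ (pv_resolvent sK (Z ^t* *m D ^t* *m F))).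
  congr pv.
  rewrite rmorphM /= -mxtrace_adj !adj_mul !adjK.
  have -> : Num.conj (pi%:C)%C = (pi%:C)%C :> C.
    by apply: complex_eqP; rewrite /= ?oppr0.
  rewrite [\tr (F ^t* *m _)]mxtrace_mulC [\tr (_ *m D)]mxtrace_mulC mulmxA.
  by rewrite -mulrDl -rmorphD /= mulr2n mulrDl mul1r.
have [cr ci _] := dec.
rewrite (cintegral_pv cr ci ir ii lim) mulrA -rmorphM /= mulVf ?mul1r//.
by rewrite mulf_neq0 ?pnatr_eq0// gt_eqF ?pi_gt0.
Qed.

End TwoSystems.

Lemma square_integrable_proper n m p (J : 'M[C]_n) (B : 'M[C]_(n, m))
    (D : 'M[C]_(p, n)) (G : C -> 'M[C]_(p, m)) : stable_mx J ->
  (forall w : R, G (w *i)%C = proper_transfer J B D (w *i)%C) ->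
  square_integrable G.
Proof.
move=> sJ EG; have [+ _] := cintegrable_inner B D B D sJ sJ.
rewrite /square_integrable; congr (_.-integrable _ _).
by apply/funext => w /=; rewrite EG.
Qed.

End ProperInner.

(** * The Weierstrass form and strictly proper systems *)

Lemma invmx_right (F : comUnitRingType) n (M X : 'M[F]_n) :
  M *m X = 1%:M -> invmx M = X.
Proof.
move=> MX; have [uM _] := mulmx1_unit MX.
by rewrite -[LHS]mulmx1 -MX mulKmx.
Qed.

Section Weierstrass.
Variable R : realType.
Local Notation C := R[i].
Local Notation Re := (@complex.Re R).
Variables (nf ninf : nat).
Local Notation n := (nf + ninf)%N.
Variables (E A P Q : 'M[C]_n) (J : 'M[C]_nf) (N : 'M[C]_ninf).

Definition weierstrass_form := [/\ P \in unitmx, Q \in unitmx,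
  P *m E *m Q = block_mx 1%:M 0 0 N, P *m A *m Q = block_mx J 0 0 1%:M &
  exists k : nat, N ^+ k = 0].

Hypothesis wf : weierstrass_form.

Let Pu : P \in unitmx. Proof. by case: wf. Qed.
Let Qu : Q \in unitmx. Proof. by case: wf. Qed.

Lemma weierstrass_pencil s :
  P *m (s *: E - A) *m Q = block_mx (s%:M - J) 0 0 (s *: N - 1%:M).
Proof.
have [_ _ EE AA _] := wf.
rewrite mulmxBr mulmxBl AA -scalemxAr -scalemxAl EE scale_block_mx.
by rewrite opp_block_mx add_block_mx !scaler0 !oppr0 !addr0 scalemx1.
Qed.

(** A nilpotent [N] makes the resolvent of the infinite part the finite Neumann
    sum, hence polynomial in [s]. *)
Lemma nilpotent_resolvent : exists k : nat, forall s,
  (s *: N - 1%:M) *m (- \sum_(i < k) s ^+ i *: N ^+ i) = 1%:M.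
Proof.
have [_ _ _ _ [k Nk]] := wf; exists k => s.
have sX i : (s *: N) ^+ i = s ^+ i *: N ^+ i.
  elim: i => [|i IH]; first by rewrite scale1r.
  by rewrite !exprS IH -!mulmxE -scalemxAl -scalemxAr scalerA.
have := subrX1 (s *: N) k; rewrite sX Nk scaler0 sub0r => H.
rewrite mulmxN; under eq_bigr do rewrite -sX.
by apply: oppr_inj; rewrite opprK; exact: esym H.
Qed.

Lemma weierstrass_stable : (forall s, \det (s *: E - A) = 0 -> Re s < 0) ->
  stable_mx J.
Proof.
move=> sEA s ds; apply: sEA.
have : \det (P *m (s *: E - A) *m Q) = 0.
  by rewrite weierstrass_pencil det_ublock ds mul0r.
rewrite !det_mulmx => /eqP; rewrite !mulf_eq0 => /orP[/orP[]|] /eqP d0 //.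
  by move: Pu; rewrite unitmxE d0 unitr0.
by move: Qu; rewrite unitmxE d0 unitr0.
Qed.

Lemma weierstrass_transfer m p (B : 'M[C]_(n, m)) (D : 'M[C]_(p, n)) s :
  s%:M - J \in unitmx ->
  D *m invmx (s *: E - A) *m B =
    proper_transfer J (usubmx (P *m B)) (lsubmx (D *m Q)) s +
    rsubmx (D *m Q) *m invmx (s *: N - 1%:M) *m dsubmx (P *m B).
Proof.
move=> uJ; have [k Nk] := nilpotent_resolvent.
have [uN _] := mulmx1_unit (Nk s).
set S := block_mx (invmx (s%:M - J)) 0 0 (invmx (s *: N - 1%:M)).
have SE : block_mx (s%:M - J) 0 0 (s *: N - 1%:M) *m S = 1%:M.
  rewrite mulmx_block !mul0mx !mulmx0 !addr0 !add0r !mulmxV//.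
  by rewrite -scalar_mx_block.
have inv : (s *: E - A) *m (Q *m S *m P) = 1%:M.
  have <- : invmx P *m (P *m (s *: E - A) *m Q) *m invmx Q = s *: E - A.
    by rewrite !mulmxA mulVmx// mul1mx mulmxK.
  rewrite weierstrass_pencil -!mulmxA mulKmx//.
  by rewrite [_ *m (S *m P)]mulmxA SE mul1mx mulVmx.
rewrite (invmx_right inv).
rewrite -!mulmxA mulmxA -[X in X *m _]hsubmxK -[X in _ *m (_ *m X)]vsubmxK.
rewrite mul_block_col !mul0mx addr0 add0r mul_row_col.
by rewrite /proper_transfer !mulmxA.
Qed.

(** The contribution of the infinite part is polynomial in [s]. It is the
    difference of two functions vanishing at infinity, hence zero. *)
Lemma strictly_proper_transfer m p (B : 'M[C]_(n, m)) (D : 'M[C]_(p, n)) :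
  stable_mx J -> strictly_proper (fun s => D *m invmx (s *: E - A) *m B) ->
  forall s, s%:M - J \in unitmx -> D *m invmx (s *: E - A) *m B =
    proper_transfer J (usubmx (P *m B)) (lsubmx (D *m Q)) s.
Proof.
move=> sJ spr s uJ; rewrite weierstrass_transfer//.
rewrite -[RHS]addr0; congr (_ + _); apply/matrixP => i j; rewrite [RHS]mxE.
have [k Nk] := nilpotent_resolvent.
pose D2 := rsubmx (D *m Q); pose B2 := dsubmx (P *m B).
pose q : {poly C} := \poly_(l < k) - (D2 *m N ^+ l *m B2) i j.
have qE z : (D2 *m invmx (z *: N - 1%:M) *m B2) i j = q.[z].
  rewrite (invmx_right (Nk z)).
  rewrite horner_poly mulmxN mulNmx mxE mulmx_sumr mulmx_suml summxE -sumrN.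
  by apply: eq_bigr => l _; rewrite -scalemxAr -scalemxAl mxE mulNr mulrC.
rewrite qE; suff -> : q = 0 by rewrite horner0.
apply: vanishing_horner.
have [r [P0 [_ _ _ rE]]] := stable_resolvent sJ.
have [t ht] := eventually_notin r.
apply: (vanishing_eventually (f := fun z => (D *m invmx (z *: E - A) *m B) i j +
  (-1) * proper_transfer J (usubmx (P *m B)) (lsubmx (D *m Q)) z i j)).
  exists t => z /ht /rE[uz _]; rewrite weierstrass_transfer// mxE qE mulN1r.
  by rewrite addrAC subrr add0r.
apply: vanishingD.
  by move=> e e0; have [r0 hr] := spr e e0; exists r0 => z /hr.
apply: vanishingZ; under eq_fun do rewrite proper_transfer_entry.
exact: vanishing_resolvent.
Qed.

End Weierstrass.

(** * Transfer functions as rational functions *)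

Section RationalAnalytic.

Lemma derivable_horner_numField (K : numFieldType) (q : {poly K}) (z : K^o) :
  derivable (horner q : K^o -> K^o) z 1.
Proof.
elim/poly_ind: q => [|q c IH].
  rewrite (_ : horner 0 = cst (0 : K^o)); first exact: derivable_cst.
  by apply/funext => x; rewrite horner0.
rewrite (_ : horner _ = (horner q : K^o -> K^o) * id + cst (c : K^o)); last first.
  by apply/funext => x; rewrite !fctE !hornerE.
apply: derivableD; last exact: derivable_cst.
by apply: derivableM; [exact: IH|exact: derivable_id].
Qed.

Lemma horner_neq0_near (K : numFieldType) (q : {poly K}) (z : K^o) :
  q.[z] != 0 -> \forall y \near z, q.[y] != 0.
Proof.
move=> qz; have cq : {for z, continuous (horner q : K^o -> K^o)}.
  exact/differentiable_continuous/derivable1_diffP/derivable_horner_numField.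
exact: cvgr_neq0 cq qz.
Qed.

Lemma derivable_rational (K : numFieldType) (f : K^o -> K^o) (u q : {poly K})
    (z : K^o) : (forall y, q.[y] != 0 -> f y = u.[y] / q.[y]) ->
  q.[z] != 0 -> derivable f z 1.
Proof.
move=> fE qz.
apply: (@near_eq_derivable _ _ _ ((horner u : K^o -> K^o) * (fun y => (horner q y)^-1))).
  by apply: filterS (horner_neq0_near qz) => y /fE ->.
apply: derivableM; first exact: derivable_horner_numField.
by apply: derivableV => //; exact: derivable_horner_numField.
Qed.

Variable R : realType.
Local Notation C := R[i].

Lemma analytic_at_rational (f : C -> C) (u q : {poly C}) (s : C) :
  (forall y, q.[y] != 0 -> f y = u.[y] / q.[y]) -> q.[s] != 0 -> analytic_at f s.
Proof.
move=> fE qs; apply: filterS (@horner_neq0_near C q s qs) => y qy.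
exact: (@derivable_rational C f u q y fE qy).
Qed.

Section Transfer.
Variables (n m p : nat) (E A : 'M[R]_n) (B : 'M[R]_(n, m)) (D : 'M[R]_(p, n)).

Definition pencil_poly : 'M[{poly C}]_n :=
  'X *: map_mx polyC (cmx E) - map_mx polyC (cmx A).

(** Cramer's rule: dividing by the determinant of the pencil gives the transfer
    function. *)
Definition transfer_num : 'M[{poly C}]_(p, m) :=
  map_mx polyC (cmx D) *m \adj pencil_poly *m map_mx polyC (cmx B).

Lemma horner_polyC_mx a b (M : 'M[C]_(a, b)) s :
  map_mx (horner_eval s) (map_mx polyC M) = M.
Proof. by apply/matrixP => i j; rewrite !mxE /horner_eval hornerC. Qed.

Lemma horner_pencil_poly s : map_mx (horner_eval s) pencil_poly = pencil E A s.
Proof.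
rewrite /pencil_poly map_mxB map_mxZ !horner_polyC_mx.
by rewrite /= /horner_eval hornerX.
Qed.

Lemma horner_pencil_det s : (\det pencil_poly).[s] = \det (pencil E A s).
Proof. by rewrite horner_det horner_pencil_poly. Qed.

Lemma transfer_rational s i j : (\det pencil_poly).[s] != 0 ->
  transfer E A B D s i j = (transfer_num i j).[s] / (\det pencil_poly).[s].
Proof.
rewrite horner_pencil_det => ds.
have -> : (transfer_num i j).[s] = (cmx D *m \adj (pencil E A s) *m cmx B) i j.
  have -> : (transfer_num i j).[s] = map_mx (horner_eval s) transfer_num i j.
    by rewrite [RHS]mxE.
  by rewrite !map_mxM !horner_polyC_mx map_mx_adj horner_pencil_poly.
rewrite /transfer /invmx unitmxE unitfE ds -scalemxAr -scalemxAl mxE.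
by rewrite mulrC.
Qed.

Lemma transfer_in_H2 : regular_pencil E A -> asymptotically_stable E A ->
  square_integrable (transfer E A B D) -> in_H2 (transfer E A B D).
Proof.
move=> [s0 reg] stab sqi; split=> //.
  exists (\det pencil_poly), transfer_num; split.
    by apply: contraNneq reg => q0; rewrite -horner_pencil_det q0 horner0.
  by move=> s qs i j; exact: transfer_rational.
move=> s s0' i j.
apply: (@analytic_at_rational _ (transfer_num i j) (\det pencil_poly)).
  by move=> y; exact: transfer_rational.
rewrite horner_pencil_det; apply/eqP => /stab.
by rewrite ltNge s0'.
Qed.

End Transfer.
End RationalAnalytic.

(** * The projected Sylvester equation *)

Section ProjectedSylvester.
Variable R : realType.
Local Notation C := R[i].

Definition corner_mx (a b : nat) : 'M[C]_(a + b) := block_mx 1%:M 0 0 0.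

Lemma corner_mulmx a b c d (M : 'M[C]_(a + b, c + d)) :
  corner_mx a b *m M *m corner_mx c d = block_mx (ulsubmx M) 0 0 0.
Proof.
rewrite -{1}[M]submxK !mulmx_block.
by rewrite !(mul0mx, mulmx0, mul1mx, mulmx1, addr0, add0r).
Qed.

Lemma corner_adj a b : (corner_mx a b)^t* = corner_mx a b.
Proof.
rewrite /corner_mx tr_block_mx map_block_mx !trmx0 !map_mx0 trmx1.
by rewrite map_mx1.
Qed.

Lemma diag_corner_mulmx a b c d (M1 : 'M[C]_a) (M2 : 'M[C]_b) (Z : 'M[C]_(a, c))
    (M3 : 'M[C]_c) (M4 : 'M[C]_d) :
  block_mx M1 0 0 M2 *m block_mx Z 0 0 0 *m block_mx M3 0 0 M4 =
  block_mx (M1 *m Z *m M3) 0 0 0.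
Proof.
by rewrite !mulmx_block !(mulmx0, mul0mx, addr0, add0r).
Qed.

Variables (nf ni hf hi : nat).
Variables (E A P Q : 'M[C]_(nf + ni)) (J : 'M[C]_nf) (N : 'M[C]_ni).
Variables (EH AH PH QH : 'M[C]_(hf + hi)) (JH : 'M[C]_hf) (NH : 'M[C]_hi).
Hypotheses (wf : weierstrass_form E A P Q J N)
  (wfH : weierstrass_form EH AH PH QH JH NH).

Local Notation Pl := (invmx P *m corner_mx nf ni *m P).
Local Notation Pr := (Q *m corner_mx nf ni *m invmx Q).
Local Notation PHl := (invmx PH *m corner_mx hf hi *m PH).
Local Notation PHr := (QH *m corner_mx hf hi *m invmx QH).

(** The matrices fixed by the two projectors are those that have only a
    finite-finite block in the coordinates of the Weierstrass forms. *)
Definition lift_corner (Z : 'M[C]_(nf, hf)) : 'M[C]_(nf + ni, hf + hi) :=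
  Q *m block_mx Z 0 0 0 *m QH ^t*.

Lemma projected_lift X : X = Pr *m X *m PHr ^t* <-> exists Z, X = lift_corner Z.
Proof.
have [_ Qu _ _ _] := wf; have [_ QHu _ _ _] := wfH.
have adjV : (invmx QH)^t* = invmx (QH ^t*) by rewrite -map_invmx trmx_inv.
have QHau : QH ^t* \in unitmx by rewrite map_unitmx unitmx_tr.
rewrite !adj_mul corner_adj adjV; split=> [->|[Z ->]].
  exists (ulsubmx (invmx Q *m X *m invmx (QH ^t*))).
  by rewrite /lift_corner -corner_mulmx !mulmxA.
have corner_block : corner_mx nf ni *m block_mx Z 0 0 0 *m corner_mx hf hi =
    block_mx Z 0 0 0 by rewrite corner_mulmx block_mxKul.
rewrite /lift_corner -!mulmxA mulKmx// mulKVmx//.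
by rewrite -[in LHS]corner_block !mulmxA.
Qed.

Variables (m p : nat) (B : 'M[C]_(nf + ni, m)) (BH : 'M[C]_(hf + hi, m)).

(** The infinite parts of both pencils only meet the zero blocks of the lift, and
    the projectors cut the constant term down to its finite corner: what is left
    is an unprojected Sylvester equation. *)
Lemma projected_residual Z :
  P *m (A *m lift_corner Z *m EH ^t* + E *m lift_corner Z *m AH ^t*
        + Pl *m B *m BH ^t* *m PHl ^t*) *m PH ^t* =
  block_mx (J *m Z + Z *m JH ^t* + usubmx (P *m B) *m (usubmx (PH *m BH))^t*) 0 0 0.
Proof.
have [Pu _ EE AA _] := wf; have [PHu _ EEH AAH _] := wfH.
have adj_block (a b c d : nat) (M1 : 'M[C]_(a, c)) (M2 : 'M[C]_(b, d)) :
    (block_mx M1 0 0 M2)^t* = block_mx (M1 ^t*) 0 0 (M2 ^t*).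
  by rewrite tr_block_mx map_block_mx !trmx0 !map_mx0.
have corner_col (a b c : nat) (M : 'M[C]_(a + b, c)) :
    corner_mx a b *m M = col_mx (usubmx M) 0.
  by rewrite -{1}[M]vsubmxK mul_block_col !mul0mx mul1mx !addr0.
rewrite !mulmxDr !mulmxDl.
have -> : P *m (A *m lift_corner Z *m EH ^t*) *m PH ^t* =
    block_mx (J *m Z) 0 0 0.
  transitivity ((P *m A *m Q) *m block_mx Z 0 0 0 *m (PH *m EH *m QH)^t*).
    by rewrite !adj_mul /lift_corner !mulmxA.
  by rewrite AA EEH adj_block trmx1 map_mx1 diag_corner_mulmx mulmx1.
have -> : P *m (E *m lift_corner Z *m AH ^t*) *m PH ^t* =
    block_mx (Z *m JH ^t*) 0 0 0.
  transitivity ((P *m E *m Q) *m block_mx Z 0 0 0 *m (PH *m AH *m QH)^t*).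
    by rewrite !adj_mul /lift_corner !mulmxA.
  by rewrite EE AAH adj_block diag_corner_mulmx mul1mx.
have -> : P *m (Pl *m B *m BH ^t* *m PHl ^t*) *m PH ^t* =
    block_mx (usubmx (P *m B) *m (usubmx (PH *m BH))^t*) 0 0 0.
  transitivity ((corner_mx nf ni *m (P *m B)) *m (corner_mx hf hi *m (PH *m BH))^t*).
    have PlP : P *m Pl = corner_mx nf ni *m P by rewrite -mulmxA mulKVmx.
    have PHlP : PHl ^t* *m PH ^t* = PH ^t* *m corner_mx hf hi.
      by rewrite -adj_mul -mulmxA mulKVmx// adj_mul corner_adj.
    transitivity ((P *m Pl) *m B *m BH ^t* *m (PHl ^t* *m PH ^t*)).
      by rewrite !mulmxA.
    by rewrite PlP PHlP !adj_mul corner_adj !mulmxA.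
  rewrite !corner_col tr_col_mx map_row_mx trmx0 map_mx0 mul_col_row.
  by rewrite !(mul0mx, mulmx0).
by rewrite !add_block_mx !addr0.
Qed.

Lemma trace_lift_corner Z (D : 'M[C]_(p, nf + ni)) (DH : 'M[C]_(p, hf + hi)) :
  \tr (D *m lift_corner Z *m DH ^t*) =
  \tr (lsubmx (D *m Q) *m Z *m (lsubmx (DH *m QH))^t*).
Proof.
have -> : D *m lift_corner Z *m DH ^t* =
    (D *m Q) *m block_mx Z 0 0 0 *m (DH *m QH)^t*.
  by rewrite adj_mul /lift_corner !mulmxA.
rewrite -{1}[D *m Q]hsubmxK -{1}[DH *m QH]hsubmxK tr_row_mx map_col_mx.
by rewrite mul_row_block mul_row_col !(mul0mx, mulmx0, addr0).
Qed.

Lemma projected_sylvester : stable_mx J -> stable_mx JH ->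
  exists Z, [/\ J *m Z + Z *m JH ^t* +
      usubmx (P *m B) *m (usubmx (PH *m BH))^t* = 0 &
    unique (fun X =>
      A *m X *m EH ^t* + E *m X *m AH ^t* + Pl *m B *m BH ^t* *m PHl ^t* = 0 /\
      X = Pr *m X *m PHr ^t*) (lift_corner Z)].
Proof.
move=> sJ sJH; have sJHa := stable_mx_adj sJH.
have [Pu _ _ _ _] := wf; have [PHu _ _ _ _] := wfH.
have PHau : PH ^t* \in unitmx by rewrite map_unitmx unitmx_tr.
have [Z solZ] := sylvester_solve sJ sJHa (usubmx (P *m B) *m (usubmx (PH *m BH))^t*).
exists Z; split=> //; split.
  split; last by apply/projected_lift; exists Z.
  apply: (can_inj (mulKmx Pu)); apply: (can_inj (mulmxK PHau)).
  by rewrite projected_residual solZ block_mx0 mulmx0 mul0mx.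
move=> X [eqX /projected_lift[Z' defX]]; rewrite defX in eqX *; congr lift_corner.
have := projected_residual Z'; rewrite eqX mulmx0 mul0mx.
rewrite -(block_mx0 _ nf ni hf hi) => /esym/eq_block_mx[solZ' _ _ _].
apply/eqP; rewrite -subr_eq0; apply/eqP/(sylvester_inj sJ sJHa).
rewrite mulmxBr mulmxBl addrACA -opprD.
by move/eqP: solZ; move/eqP: solZ'; rewrite !addr_eq0 => /eqP -> /eqP ->; rewrite subrr.
Qed.

End ProjectedSylvester.

(** * Real realizations and duality *)

Section RealData.
Variable R : realType.
Local Notation C := R[i].

Lemma cmxM m n p (M : 'M[R]_(m, n)) (N : 'M[R]_(n, p)) :
  cmx (M *m N) = cmx M *m cmx N.
Proof. exact: map_mxM. Qed.

Lemma cmx_invmx n (M : 'M[R]_n) : cmx (invmx M) = invmx (cmx M).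
Proof. exact: map_invmx. Qed.

Lemma cmx_tr m n (M : 'M[R]_(m, n)) : cmx M^T = (cmx M)^t*.
Proof.
by apply/matrixP => i j; rewrite !mxE; apply: complex_eqP; rewrite //= oppr0.
Qed.

Lemma trmx_cmx m n (M : 'M[R]_(m, n)) : (cmx M)^T = cmx M^T.
Proof. by rewrite /cmx map_trmx. Qed.

Lemma cmx_diag a b (J : 'M[R]_a) (N : 'M[R]_b) :
  cmx (block_mx J 0 0 N) = block_mx (cmx J) 0 0 (cmx N).
Proof. by rewrite /cmx map_block_mx !map_mx0. Qed.

Lemma cmx1 n : cmx (1%:M : 'M[R]_n) = 1%:M.
Proof. exact: map_mx1. Qed.

Lemma cmx_corner a b : cmx (block_mx 1%:M 0 0 0 : 'M[R]_(a + b)) = corner_mx R a b.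
Proof. by rewrite cmx_diag cmx1 /cmx map_mx0. Qed.

Lemma cmxX n (M : 'M[R]_n) k : cmx (M ^+ k) = cmx M ^+ k.
Proof.
elim: k => [|k IH]; first exact: cmx1.
by rewrite !exprS -!mulmxE cmxM IH.
Qed.

Lemma weierstrass_cmx nf ni (E A P Q : 'M[R]_(nf + ni)) J N (k : nat) :
  P \in unitmx -> Q \in unitmx -> N ^+ k = 0 ->
  P *m E *m Q = block_mx 1%:M 0 0 N -> P *m A *m Q = block_mx J 0 0 1%:M ->
  weierstrass_form (cmx E) (cmx A) (cmx P) (cmx Q) (cmx J) (cmx N).
Proof.
move=> Pu Qu Nk EE AA; split.
- by rewrite map_unitmx.
- by rewrite map_unitmx.
- by rewrite -!cmxM EE cmx_diag cmx1.
- by rewrite -!cmxM AA cmx_diag cmx1.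
- by exists k; rewrite -cmxX Nk /cmx map_mx0.
Qed.

(** The half of the theorem about [X]; the half about [Y] is this one for the
    transposed systems. *)
Lemma H2_inner_projected_sylvester (n nH m p : nat)
  (E A : 'M[R]_n) (B : 'M[R]_(n, m)) (D : 'M[R]_(p, n))
  (EH AH : 'M[R]_nH) (BH : 'M[R]_(nH, m)) (DH : 'M[R]_(p, nH))
  (Pl Pr : 'M[R]_n) (PHl PHr : 'M[R]_nH) :
  regular_pencil E A -> regular_pencil EH AH ->
  asymptotically_stable E A -> asymptotically_stable EH AH ->
  strictly_proper (transfer E A B D) ->
  strictly_proper (transfer EH AH BH DH) ->
  spectral_projectors E A Pl Pr -> spectral_projectors EH AH PHl PHr ->
  let G := transfer E A B D in
  let GH := transfer EH AH BH DH in
  [/\ in_H2 G, in_H2 GH & exists2 X : 'M[C]_(n, nH),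
     unique (fun X' : 'M[C]_(n, nH) =>
          cmx A *m X' *m (cmx EH) ^t* + cmx E *m X' *m (cmx AH) ^t*
            + cmx Pl *m cmx B *m (cmx BH) ^t* *m (cmx PHl) ^t* = 0 /\
          X' = cmx Pr *m X' *m (cmx PHr) ^t*) X &
     H2_inner G GH = \tr (cmx D *m X *m (cmx DH) ^t*)].
Proof.
move=> reg regH stab stabH sp spH [nf [ni [en [P [Q [J [N]]]]]]].
move=> [[Pu Qu] [k Nk] + + []].
move=> + + + + [hf [hi [enH [PH [QH [JH [NH]]]]]]].
move=> + + + + [[PHu QHu] [kH NHk] + + []].
subst n nH; rewrite !castmx_id => EE AA -> -> EEH AAH -> -> G GH.
have wf := weierstrass_cmx Pu Qu Nk EE AA.
have wfH := weierstrass_cmx PHu QHu NHk EEH AAH.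
have sJ := weierstrass_stable wf stab.
have sJH := weierstrass_stable wfH stabH.
have axis_ge0 (w : R) : 0 <= complex.Re (w *i)%C by [].
have GE w := strictly_proper_transfer wf sJ sp (stable_mx_unit sJ (axis_ge0 w)).
have GHE w := strictly_proper_transfer wfH sJH spH (stable_mx_unit sJH (axis_ge0 w)).
split.
- apply: transfer_in_H2 => //; exact: square_integrable_proper sJ GE.
- apply: transfer_in_H2 => //; exact: square_integrable_proper sJH GHE.
have [Z [solZ uniZ]] := projected_sylvester wf wfH (cmx B) (cmx BH) sJ sJH.
exists (lift_corner (cmx Q) (cmx QH) Z).
  by rewrite !cmxM !cmx_invmx !cmx_corner.
rewrite trace_lift_corner.
exact: (H2_inner_proper sJ sJH solZ GE GHE).
Qed.

(** Transposing a realization transposes the transfer function, exchanges the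
    input and output matrices, and exchanges the left and right projectors. *)
Section Dual.
Variables (n m p : nat) (E A : 'M[R]_n) (B : 'M[R]_(n, m)) (D : 'M[R]_(p, n)).

Lemma pencil_tr s : pencil E^T A^T s = (pencil E A s)^T.
Proof. by rewrite /pencil linearB linearZ /= !trmx_cmx. Qed.

Lemma transfer_tr s : transfer E^T A^T D^T B^T s = (transfer E A B D s)^T.
Proof.
by rewrite /transfer pencil_tr !trmx_mul trmx_inv !trmx_cmx mulmxA.
Qed.

Lemma regular_pencil_tr : regular_pencil E A -> regular_pencil E^T A^T.
Proof. by move=> [s ds]; exists s; rewrite pencil_tr det_tr. Qed.

Lemma asymptotically_stable_tr :
  asymptotically_stable E A -> asymptotically_stable E^T A^T.
Proof. by move=> st s; rewrite pencil_tr det_tr; exact: st. Qed.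

Lemma strictly_proper_tr : strictly_proper (transfer E A B D) ->
  strictly_proper (transfer E^T A^T D^T B^T).
Proof.
move=> sp e e0; have [r hr] := sp e e0; exists r => s rs i j.
by rewrite transfer_tr mxE; exact: hr.
Qed.

End Dual.

Lemma spectral_projectors_tr n (E A Pl Pr : 'M[R]_n) :
  spectral_projectors E A Pl Pr -> spectral_projectors E^T A^T Pr^T Pl^T.
Proof.
move=> [nf [ni [en [P [Q [J [N [[Pu Qu] [k Nk] + + []]]]]]]]].
subst n; rewrite !castmx_id => EE AA -> ->.
exists nf, ni, erefl, Q^T, P^T, J^T, N^T; rewrite /= !castmx_id; split.
- by rewrite !unitmx_tr.
- exists k; suff -> : N^T ^+ k = (N ^+ k)^T by rewrite Nk trmx0.
  elim: k {Nk} => [|k IH]; first by rewrite !expr0 trmx1.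
  by rewrite exprSr exprS IH -!mulmxE trmx_mul.
- by rewrite -!trmx_mul mulmxA EE tr_block_mx !trmx0 trmx1.
- by rewrite -!trmx_mul mulmxA AA tr_block_mx !trmx0 trmx1.
- by rewrite !trmx_mul !trmx_inv tr_block_mx !trmx0 trmx1 !mulmxA.
Qed.

(** The traces of [G^T] times the adjoint of [H^T] and of [G] times the adjoint
    of [H] agree at every point, by cyclicity. *)
Lemma H2_inner_tr m p (G H : C -> 'M[C]_(p, m)) :
  H2_inner (fun s => (G s)^T) (fun s => (H s)^T) = H2_inner G H.
Proof.
rewrite /H2_inner; congr (_ * cintegral _); apply/funext => w.
rewrite -[in RHS]mxtrace_tr trmx_mul mxtrace_mulC; congr (\tr (_ *m _)).
by rewrite map_trmx.
Qed.

End RealData.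

Theorem theorem6 (R : realType) (n nH m p : nat)
  (E A : 'M[R]_n) (B : 'M[R]_(n, m)) (C : 'M[R]_(p, n))
  (EH AH : 'M[R]_nH) (BH : 'M[R]_(nH, m)) (CH : 'M[R]_(p, nH))
  (Pl Pr : 'M[R]_n) (PHl PHr : 'M[R]_nH)
  (reg : regular_pencil E A) (regH : regular_pencil EH AH)
  (stab : asymptotically_stable E A) (stabH : asymptotically_stable EH AH)
  (sp : strictly_proper (transfer E A B C))
  (spH : strictly_proper (transfer EH AH BH CH))
  (proj : spectral_projectors E A Pl Pr)
  (projH : spectral_projectors EH AH PHl PHr) :
  let G := transfer E A B C in
  let GH := transfer EH AH BH CH in
  in_H2 G /\ in_H2 GH /\
  exists X Y : 'M[R[i]]_(n, nH),
    [/\ unique (fun X' : 'M[R[i]]_(n, nH) =>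
          cmx A *m X' *m (cmx EH) ^t* + cmx E *m X' *m (cmx AH) ^t*
            + cmx Pl *m cmx B *m (cmx BH) ^t* *m (cmx PHl) ^t* = 0 /\
          X' = cmx Pr *m X' *m (cmx PHr) ^t*) X,
        unique (fun Y' : 'M[R[i]]_(n, nH) =>
          (cmx A) ^t* *m Y' *m cmx EH + (cmx E) ^t* *m Y' *m cmx AH
            + (cmx Pr) ^t* *m (cmx C) ^t* *m cmx CH *m cmx PHr = 0 /\
          Y' = (cmx Pl) ^t* *m Y' *m cmx PHl) Y,
        H2_inner G GH = \tr (cmx C *m X *m (cmx CH) ^t*) &
        H2_inner G GH = \tr ((cmx B) ^t* *m Y *m cmx BH)].
Proof.
move=> G GH.
have [G_H2 GH_H2 [X uniX innerX]] :=
  H2_inner_projected_sylvester reg regH stab stabH sp spH proj projH.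
have [_ _ [Y uniY innerY]] := H2_inner_projected_sylvester
  (regular_pencil_tr reg) (regular_pencil_tr regH)
  (asymptotically_stable_tr stab) (asymptotically_stable_tr stabH)
  (strictly_proper_tr sp) (strictly_proper_tr spH)
  (spectral_projectors_tr proj) (spectral_projectors_tr projH).
rewrite !cmx_tr !adjK in uniY innerY.
split=> //; split=> //; exists X, Y; split=> //.
have GT : transfer E^T A^T C^T B^T = (fun s => (G s)^T).
  by apply/funext => s; rewrite transfer_tr.
have GHT : transfer EH^T AH^T CH^T BH^T = (fun s => (GH s)^T).
  by apply/funext => s; rewrite transfer_tr.
by rewrite -innerY GT GHT H2_inner_tr.
Qed.
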